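(* For $(\mathcal L,\boldsymbol\tau)\sim\widetilde X_n$ set $$\rho_{\rm aff}(\mathcal L,\boldsymbol\tau):=\min_{\mathbf z\in\boldsymbol\tau+\mathcal L}\|\mathbf z\|,\qquad U_{\rm aff}:=\kappa_n\,\rho_{\rm aff}(\mathcal L,\boldsymbol\tau)^n .$$ For every $u,t>0$, $$\mathbb P[U_{\rm aff}\le u]\le u,\qquad\mathbb P[U_{\rm aff}>t]\le\frac1t .$$ In particular, with $\ell:=\lceil\log n\rceil$, $$\mathbb P\Bigl[\Bigl(1-\frac1\ell\Bigr)R^*\le\rho_{\rm aff}(\mathcal L,\boldsymbol\tau)\le\Bigl(1+\frac1\ell\Bigr)R^*\Bigr]\ge1-e^{-\Omega(n/\log n)} .$$
   Context: $X_n=\mathrm{SL}_n(\mathbb R)/\mathrm{SL}_n(\mathbb Z)$ ($n\ge2$) is the space of unimodular lattices in $\mathbb R^n$ with its Haar probability measure. $\widetilde X_n$ is the probability space of pairs $(\mathcal L,\boldsymbol\tau)$ with $\mathcal L$ sampled from $X_n$ and, conditionally on $\mathcal L$, $\boldsymbol\tau$ Haar-uniform on the torus $\mathbb R^n/\mathcal L$; $\boldsymbol\tau+\mathcal L$ is the corresponding affine lattice. $\kappa_n$ is the volume of the Euclidean unit ball in $\mathbb R^n$ and $R^*:=\kappa_n^{-1/n}$. Logarithms are natural; $e^{-\Omega(n/\log n)}$ means a bound $e^{-an/\log n}$ for some $a>0$ and all sufficiently large $n$. *)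

(* Defs.v *)
From HB Require Import structures.
From mathcomp Require Import all_boot all_order all_algebra.
From mathcomp Require Import all_classical all_reals all_analysis measurable_realfun.

Set Implicit Arguments.
Unset Strict Implicit.
Unset Printing Implicit Defensive.

Import Order.TTheory GRing.Theory Num.Theory.
Import numFieldNormedType.Exports.

Local Open Scope classical_set_scope.
Local Open Scope ring_scope.

Section Euclidean.
Variables (R : realType) (n : nat).
Implicit Types (x y : 'cV[R]_n) (L : set 'cV[R]_n).

(* [`|x|] on matrices is the sup norm, hence a separate Euclidean norm. *)
Definition enorm x : R := Num.sqrt (\sum_i x i 0 ^+ 2).

Definition box (a b : 'cV[R]_n) : set 'cV[R]_n :=
  [set x | forall i, a i 0 <= x i 0 <= b i 0].

(* Lebesgue outer measure on R^n (for n > 0). *)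
Definition volume (A : set 'cV[R]_n) : \bar R :=
  ereal_inf [set s | exists a b : nat -> 'cV[R]_n,
    [/\ forall k i, a k i 0 <= b k i 0,
        A `<=` \bigcup_k box (a k) (b k)
      & s = (\sum_(0 <= k <oo) (\prod_i (b k i 0 - a k i 0))%:E)%E]].

Definition kappa : R := fine (volume [set x | enorm x <= 1]).

Definition Rstar : R := kappa `^ (- n%:R^-1).

Definition translate x L : set 'cV[R]_n := [set x + v | v in L].

Definition SL : set 'M[R]_n := [set g | \det g = 1].

Definition lattice_of (g : 'M[R]_n) : set 'cV[R]_n :=
  [set g *m map_mx intr k | k in [set: 'cV[int]_n]].

End Euclidean.

Arguments kappa : clear implicits.
Arguments Rstar : clear implicits.
Arguments SL : clear implicits.

(* The quotient topology along [f], as a family of sets. *)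
Definition quotient_opens (S : topologicalType) (T : Type) (f : S -> T) :
  set (set T) := [set U | open (f @^-1` U)].

Section UnimodularLattices.
Variables (R : realType) (n : nat).

Record lattice := Lattice {
  lattice_points :> set 'cV[R]_n;
  lattice_unimodular : exists2 g, SL R n g & lattice_points = lattice_of g }.

HB.instance Definition _ := gen_eqMixin lattice.
HB.instance Definition _ := gen_choiceMixin lattice.

Lemma lattice_ext (L1 L2 : lattice) :
  lattice_points L1 = lattice_points L2 -> L1 = L2.
Proof.
case: L1 L2 => [L1 h1] [L2 h2] /= e; rewrite -e in h2 *.
by congr Lattice; exact: Prop_irrelevance.
Qed.

Lemma SL_val (g : SL R n) : SL R n (\val g).
Proof. by have := valP g; rewrite inE. Qed.

Definition lattice_proj (g : SL R n) : lattice :=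
  @Lattice (lattice_of (\val g)) (ex_intro2 _ _ (\val g) (SL_val g) erefl).

(* [lattice_proj] identifies SL_n(R) / SL_n(Z) with [lattice]. *)
Lemma lattice_proj_surj (L : lattice) : exists g, lattice_proj g = L.
Proof.
case: L => L [g detg eL]; have gS : g \in SL R n by rewrite inE.
by exists (exist _ g gS : SL R n); apply: lattice_ext => /=; exact: esym.
Qed.

Lemma lattice_of_subset (g h : 'M[R]_n) : lattice_of g `<=` lattice_of h ->
  exists c : 'M[int]_n, g = h *m map_mx intr c.
Proof.
move=> gh; have /choice [c cE] (j : 'I_n) :
    exists k : 'cV[int]_n, h *m map_mx intr k = col j g.
  have [|k _ <-] := gh (col j g); last by exists k.
  exists (delta_mx j 0) => //; rewrite map_delta_mx /=.
  by rewrite -colE.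
exists (\matrix_(i, j) c j i 0); apply/matrixP => i j.
have /matrixP/(_ i 0) := cE j; rewrite !mxE => <-.
by apply: eq_bigr => k _; rewrite !mxE.
Qed.

Lemma lattice_proj_eq (g h : SL R n) : lattice_proj g = lattice_proj h <->
  exists2 c : 'M[int]_n, \det c = 1 & \val g = \val h *m map_mx intr c.
Proof.
have key (a b : 'M[R]_n) (c : 'M[int]_n) : a = b *m map_mx intr c ->
    lattice_of a `<=` lattice_of b.
  move=> -> _ [k _ <-]; exists (c *m k) => //.
  by rewrite map_mxM mulmxA.
split=> [e | [c detc gE]].
  have /lattice_of_subset[c cE] : lattice_of (\val g) `<=` lattice_of (\val h).
    by rewrite -[lattice_of (\val g)]/(lattice_points (lattice_proj g)) e.
  exists c => //; apply: (@intr_inj R).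
  move: (SL_val g); rewrite /SL/= cE det_mulmx (SL_val h) mul1r.
  by rewrite det_map_mx rmorph1.
apply: lattice_ext; apply/seteqP; split; first exact: key gE.
apply: (key _ _ (\adj c)); rewrite gE -mulmxA -map_mxM mul_mx_adj detc.
by rewrite map_scalar_mx rmorph1 mulmx1.
Qed.

Lemma lattice_std : exists2 g, SL R n g & lattice_of 1%:M = lattice_of g.
Proof. by exists 1%:M => //; rewrite /SL/= det1. Qed.

HB.instance Definition _ := isPointed.Build lattice (Lattice lattice_std).

Lemma lattice_act_subproof (g : SL R n) (L : lattice) : exists2 h, SL R n h &
  [set \val g *m v | v in lattice_points L] = lattice_of h.
Proof.
case: L => _ /= [h deth ->]; exists (\val g *m h).
  by rewrite /SL/= det_mulmx (SL_val g) deth mulr1.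
apply/seteqP; split=> [_ [_ [k _ <-] <-]|_ [k _ <-]].
  by exists k; rewrite // mulmxA.
by exists (h *m map_mx intr k); [exists k | rewrite mulmxA].
Qed.

Definition lattice_act (g : SL R n) (L : lattice) : lattice :=
  Lattice (lattice_act_subproof g L).

(* X_n with its Borel sigma-algebra *)
Definition X := g_sigma_algebraType (quotient_opens lattice_proj).

Definition lattice_haar (mu : probability X R) : Prop :=
  forall (g : SL R n) (A : set X), measurable A ->
    mu (lattice_act g @^-1` A) = mu A.

End UnimodularLattices.

Section Torus.
Variables (R : realType) (n : nat) (L : lattice R n).

(* R^n / L as the set of cosets of L *)
Record torus := Torus {
  torus_points :> set 'cV[R]_n;
  torus_coset : exists x, torus_points = translate x L }.

HB.instance Definition _ := gen_eqMixin torus.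
HB.instance Definition _ := gen_choiceMixin torus.

Definition torus_proj (x : 'cV[R]_n) : torus :=
  @Torus (translate x L) (ex_intro _ x erefl).

HB.instance Definition _ := isPointed.Build torus (torus_proj 0).

Lemma torus_add_subproof (y : 'cV[R]_n) (t : torus) :
  exists x, translate y (torus_points t) = translate x L.
Proof.
case: t => _ /= [x ->]; exists (y + x).
apply/seteqP; split=> [_ [_ [v Lv <-] <-]|_ [v Lv <-]].
  by exists v; rewrite // addrA.
by exists (x + v); [exists v | rewrite addrA].
Qed.

Definition torus_add (y : 'cV[R]_n) (t : torus) : torus :=
  Torus (torus_add_subproof y t).

Definition borel_torus := g_sigma_algebraType (quotient_opens torus_proj).

Definition torus_haar (nu : probability borel_torus R) : Prop :=
  forall (y : 'cV[R]_n) (A : set borel_torus), measurable A ->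
    nu (torus_add y @^-1` A) = nu A.

End Torus.

Section AffineLattices.
Variables (R : realType) (n : nat).

Definition affine_lattice := {L : lattice R n & torus L}.

HB.instance Definition _ := gen_eqMixin affine_lattice.
HB.instance Definition _ := gen_choiceMixin affine_lattice.

Definition affine_proj (gx : SL R n * 'cV[R]_n) : affine_lattice :=
  existT (@torus R n) (lattice_proj gx.1) (torus_proj (lattice_proj gx.1) gx.2).

HB.instance Definition _ := isPointed.Build affine_lattice
  (existT (@torus R n) point point).

(* Topologised as a quotient of SL_n(R) x R^n. *)
Definition Xaff := g_sigma_algebraType (quotient_opens affine_proj).

(* [nu] is the regular conditional distribution of tau given L. *)
Definition affine_haar (P : probability Xaff R) : Prop :=
  exists (mu : probability (X R n) R)
         (nu : forall L : lattice R n, probability (borel_torus L) R),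
    [/\ lattice_haar mu,
        forall L, torus_haar (nu L)
      & forall A : set Xaff, measurable A ->
          let cond (L : X R n) : \bar R :=
            nu L [set tau | A (existT (@torus R n) L tau)] in
          measurable_fun [set: X R n] cond /\ P A = (\int[mu]_L cond L)%E].

Definition affine_points (S : affine_lattice) : set 'cV[R]_n :=
  torus_points (projT2 S).

(* The infimum is attained, see [rho_aff_min]. *)
Definition rho_aff (S : affine_lattice) : R :=
  inf [set enorm z | z in affine_points S].

Definition U_aff (S : affine_lattice) : R := kappa R n * rho_aff S ^+ n.

Lemma ler_enorm (x : 'cV[R]_n) i : `|x i 0| <= enorm x.
Proof.
rewrite /enorm -sqrtr_sqr ler_wsqrtr// (bigD1 i)//= lerDl.
by apply: sumr_ge0 => j _; exact: sqr_ge0.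
Qed.

Lemma finite_int_box (M : nat) :
  finite_set [set k : 'cV[int]_n | forall i, `|k i 0| <= M%:Z].
Proof.
pose f (u : {ffun 'I_n -> 'I_(2 * M).+1}) : 'cV[int]_n :=
  \col_i ((u i : nat)%:Z - M%:Z).
apply: (@sub_finite_set _ _ (f @` setT)); last first.
  by apply: finite_image; exact: finite_finset.
move=> k kM; exists [ffun i => inord (absz (k i 0 + M%:Z))] => //.
apply/matrixP => i j; rewrite [j]ord1 !mxE ffunE.
have := kM i; rewrite ler_norml => /andP[h1 h2].
have k0 : 0 <= k i 0 + M%:Z by rewrite addrC -lerBlDl sub0r.
rewrite inordK; first by rewrite gez0_abs// addrK.
by rewrite ltnS -lez_nat gez0_abs// mul2n -addnn PoszD lerD2r.
Qed.

Lemma affine_points_finite (S : affine_lattice) (C : R) :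
  finite_set (affine_points S `&` [set z | enorm z <= C]).
Proof.
case: S => L [T [x Tx]]; rewrite /affine_points /= {T}Tx.
case: L => L [g detg /= ->].
have gu : g \in unitmx by rewrite unitmxE detg unitr1.
pose B : R := \sum_i \sum_j `|invmx g i j| * (C + `|x j 0|).
have [M BM] : exists M : nat, B <= M%:R.
  by exists (Num.truncn B).+1; apply/ltW; exact: truncnS_gt.
pose f (k : 'cV[int]_n) := x + g *m map_mx intr k.
apply: (@sub_finite_set _ _ (f @` [set k : 'cV[int]_n | forall i, `|k i 0| <= M%:Z]));
  last by apply: finite_image; exact: finite_int_box.
move=> _ [[_ [k _ <-] <-] /= zC]; exists k => //= i.
rewrite -(ler_int R) intr_norm; apply: le_trans BM.
pose z := x + g *m map_mx intr k.
have -> : (k i 0)%:~R = (invmx g *m (z - x)) i 0.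
  by rewrite /z [x + _]addrC addrK mulKmx// mxE.
have F a b : 0 <= `|invmx g a b| * (C + `|x b 0|).
  by rewrite mulr_ge0// addr_ge0// (le_trans _ zC)// sqrtr_ge0.
apply: (@le_trans _ _ (\sum_j `|invmx g i j| * (C + `|x j 0|))); last first.
  rewrite /B [leRHS](bigD1 i)//= lerDl.
  by apply: sumr_ge0 => a _; apply: sumr_ge0.
rewrite mxE; apply: (le_trans (ler_norm_sum _ _ _)); apply: ler_sum => j _.
rewrite normrM ler_wpM2l// !mxE; apply: (le_trans (ler_normB _ _)).
by rewrite lerD2r -/z; apply: le_trans zC; have := ler_enorm z j; rewrite !mxE.
Qed.

Lemma rho_aff_min (S : affine_lattice) :
  exists2 z, affine_points S z &
    rho_aff S = enorm z /\ forall w, affine_points S w -> enorm z <= enorm w.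
Proof.
have [z0 Sz0] : exists z, affine_points S z.
  case: S => L [T [x Tx]]; rewrite /affine_points /= {T}Tx.
  by case: L => L [g _ /= ->]; exists (x + g *m map_mx intr 0);
    exists (g *m map_mx intr 0) => //; exists 0.
have /finite_seqP[s sE] := affine_points_finite S (enorm z0).
have z0s : z0 \in s.
  by change ([set` s] z0); rewrite -sE; split=> /=.
have [z zs zmin] : exists2 z, z \in s & forall w, w \in s -> enorm z <= enorm w.
  elim: s {sE} z0 z0s {Sz0} => // a [_ z0 _|b s IH z0 _].
    by exists a; rewrite ?inE// => w; rewrite inE => /eqP->.
  have [z zs zmin] := IH b (mem_head _ _).
  have [az|/ltW za] := leP (enorm a) (enorm z).
    exists a; rewrite ?mem_head// => w; rewrite in_cons => /orP[/eqP->//|ws].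
    exact: le_trans az (zmin _ ws).
  exists z; first by rewrite in_cons zs orbT.
  by move=> w; rewrite in_cons => /orP[/eqP->//|]; exact: zmin.
have [Sz _] : (affine_points S `&` [set z | enorm z <= enorm z0]) z.
  by rewrite sE.
have zle w : affine_points S w -> enorm z <= enorm w.
  move=> Sw; have [wz0|/ltW wz0] := leP (enorm w) (enorm z0).
    by apply: zmin; change ([set` s] w); rewrite -sE.
  exact: le_trans (zmin _ z0s) wz0.
exists z => //; split=> //; apply/eqP; rewrite eq_le; apply/andP; split.
  by apply: ge_inf; [exists 0 => _ [w _ <-]; exact: sqrtr_ge0 | exists z].
by apply: lb_le_inf; [exists (enorm z), z | move=> _ [w Sw <-]; exact: zle].
Qed.

End AffineLattices.

(* Main.v *)
Require Import Defs.
From mathcomp Require Import all_boot all_order all_algebra.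
From mathcomp Require Import all_classical all_reals all_analysis measurable_realfun.
From mathcomp Require Import fingroup perm ring lra.

(** Let [N] be the number of points of the random affine lattice in a ball of
    volume [V]; then [U_aff > V] means [N = 0]. Conditionally on the lattice the
    mean of [N] is [V], since the lattice has covolume 1. So [N >= 1] has
    probability at most [V], which is the first bound. The second bound is
    Chebyshev's inequality: the probability of [N = 0] is at most [Var N / V^2],
    and [Var N <= V] holds as soon as the mean number of ordered pairs of
    distinct points is at most [V^2]. That is the upper half of Siegel's mean
    value theorem. With [V = (1 - 1/l)^n] and [V = (1 + 1/l)^n] the two bounds
    give the concentration of [rho_aff].

    Volumes and tori. Everything is reduced to half-open cubes and counting. The
    number of points of [h Z^n] in a cube of side [T] is at most about
    [T^n / |det h|] ([sparse_det]); this is proved by Gaussian elimination,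
    because the property passes to products. Used for [h] and for [h^-1] when
    [det h = 1], it shows that a small cube of side [T] has Haar measure exactly
    [T^n] in the torus of [h Z^n] ([nu_cube]). Covering by boxes then gives the
    first bound ([nu_le_volume], [prob_U_le]). For the second bound a ball is
    approximated from inside by finitely many cubes ([ball_cubes]), and the
    second moment is a finite sum over pairs of cubes ([nu_miss_le]).

    Siegel's theorem without uniqueness of invariant measures. Since the law of
    the lattice is invariant, the conditional probability of a miss at [L] may
    be replaced by its average over the lattices [g L] for any finite family of
    matrices [g]. Take [g v = (q^-m v_0, q (v' + v_0 x))] with [n = 1 + m] and
    [x] in a fine grid of [[0, 1]^m]. For every fixed [L], as [q] tends to
    infinity, the mean number of nonzero vectors of [L] that [g] moves into a
    cube of side [T] is at most [T^n + o(1)] ([mean_weight]): a vector [v] gets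
    there with probability about [(T / (q |v_0|))^m]; the vectors with [v_0] in
    an interval of length [b] around [s] that can get there at all lie in a box
    with one side [b] and [m] sides of length about [|s|], so that together they
    contribute about [b (T / q)^m], independently of [s]; and [v_0] ranges over
    an interval of length [q^m T]. Dominated convergence on the space of
    lattices concludes ([prob_miss_cubes]). *)

Set Implicit Arguments.
Unset Strict Implicit.
Unset Printing Implicit Defensive.

Import Order.TTheory GRing.Theory Num.Theory.
Import numFieldNormedType.Exports.

Local Open Scope classical_set_scope.
Local Open Scope ring_scope.

(** * Lattice points in cubes *)

Section Counting.
Variable R : realType.

(** Counting by fibres, in the weighted form that the average over shears needs. *)
Lemma sum_fibers (T K : eqType) (s : seq T) (f : T -> K) (F : T -> R) (B : R) :
    (forall j, j \in map f s -> \sum_(k <- s | f k == j) F k <= B) ->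
  \sum_(k <- s) F k <= (size (undup (map f s)))%:R * B.
Proof.
move=> FB.
have -> : \sum_(k <- s) F k =
    \sum_(j <- undup (map f s)) \sum_(k <- s | f k == j) F k.
  rewrite (exchange_big_dep xpredT)//= big_seq [RHS]big_seq.
  apply: eq_bigr => k ks; rewrite -big_filter.
  rewrite (_ : [seq _ <- _ | _] = [:: f k]) ?big_seq1//.
  rewrite (eq_filter (a2 := pred1 (f k))); last by move=> j; rewrite /= eq_sym.
  by rewrite filter_pred1_uniq ?undup_uniq// mem_undup map_f.
rewrite big_seq; apply: (@le_trans _ _ (\sum_(j <- undup (map f s)) B)).
  rewrite [leRHS]big_seq; apply: ler_sum => j; rewrite mem_undup => jfs.
  exact: FB.
by rewrite big_const_seq count_predT iter_addr addr0 mulr_natl.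
Qed.

Lemma size_fibers (T K : eqType) (s : seq T) (f : T -> K) (A B : R) :
    0 <= B -> (size (undup (map f s)))%:R <= A ->
    (forall j, (size [seq k <- s | f k == j])%:R <= B) ->
  (size s)%:R <= A * B.
Proof.
move=> B0 sA sB.
have -> : (size s)%:R = \sum_(k <- s) 1 :> R.
  by rewrite big_const_seq count_predT iter_addr addr0.
apply: (@le_trans _ _ ((size (undup (map f s)))%:R * B)).
  apply: sum_fibers => j _.
  by rewrite big_const_seq iter_addr addr0 -size_filter; exact: sB.
by rewrite ler_wpM2r.
Qed.

Lemma size_int_itv (s : seq int) (x l : R) : uniq s -> 0 <= l ->
  (forall j, j \in s -> x <= j%:~R < x + l) -> (size s)%:R <= l + 1.
Proof.
move=> us l0 sx; pose c := Num.ceil x.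
have cx : x <= c%:~R by exact: ceil_ge.
apply: (@le_trans _ _ ((Num.truncn l).+1)%:R); last first.
  by rewrite -addn1 natrD lerD2r truncn_le.
rewrite ler_nat -(size_iota 0 (Num.truncn l).+1).
rewrite -(size_map (fun i : nat => c + i%:Z)); apply: uniq_leq_size => // j js.
have /andP[xj jxl] := sx _ js.
have cj : c <= j by rewrite ceil_le_int.
apply/mapP; exists (absz (j - c)); last by rewrite gez0_abs ?subr_ge0// addrCA subrr addr0.
rewrite mem_iota add0n leq0n /= ltnS truncn_ge_nat//.
rewrite natr_absz ger0_norm ?subr_ge0// intrB; lra.
Qed.

Lemma size_int_affine (s : seq int) (a y l : R) : uniq s -> 0 <= l -> a != 0 ->
  (forall j, j \in s -> y <= a * j%:~R < y + l) -> (size s)%:R <= l / `|a| + 1.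
Proof.
move=> us l0 a0 ay.
have [ap|] := ltP 0 a.
  apply: (@size_int_itv _ (y / a)) => //; first by rewrite divr_ge0.
  move=> k /ay; rewrite gtr0_norm// -mulrDl ler_pdivrMr// ltr_pdivlMr//.
  by rewrite mulrC.
rewrite le_eqVlt (negbTE a0)/= => an.
rewrite -(size_map -%R); apply: (@size_int_itv _ (y / - a)) => //.
- by rewrite map_inj_uniq//; exact: oppr_inj.
- by rewrite divr_ge0.
- move=> k /mapP[l' /ay + ->]; rewrite ltr0_norm// -mulrDl.
  rewrite ler_pdivrMr ?oppr_gt0// ltr_pdivlMr ?oppr_gt0//.
  by rewrite rmorphN/= mulrNN mulrC.
Qed.

Definition in_cube n (x : 'cV[R]_n) (T : R) (y : 'cV[R]_n) : bool :=
  [forall i, x i 0 <= y i 0 < x i 0 + T].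

Lemma in_cubeP n (x : 'cV[R]_n) (T : R) (y : 'cV[R]_n) :
  reflect (forall i, x i 0 <= y i 0 < x i 0 + T) (in_cube x T y).
Proof. exact: forallP. Qed.

Lemma in_cube_col m n (x : 'cV[R]_(m + n)) (T : R) u v :
  in_cube x T (col_mx u v) = in_cube (usubmx x) T u && in_cube (dsubmx x) T v.
Proof.
apply/in_cubeP/andP => [xuv|[/in_cubeP xu /in_cubeP xv] i].
  split; apply/in_cubeP => i.
    by have := xuv (lshift n i); rewrite col_mxEu !mxE.
  by have := xuv (rshift m i); rewrite col_mxEd !mxE.
case: (split_ordP i) => j ->; last by have := xv j; rewrite col_mxEd !mxE.
by have := xu j; rewrite col_mxEu !mxE.
Qed.

Lemma col_mx_map_int m n (k : 'cV[int]_(m + n)) :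
  map_mx intr k = col_mx (map_mx intr (usubmx k)) (map_mx intr (dsubmx k)) :> 'cV[R]__.
Proof. by rewrite -map_col_mx vsubmxK. Qed.

Lemma uniq_fiber_usubmx m n (s : seq 'cV[int]_(m + n)) j : uniq s ->
  uniq [seq dsubmx k | k <- s & usubmx k == j].
Proof.
move=> us; rewrite map_inj_in_uniq ?filter_uniq//.
move=> k l; rewrite !mem_filter => /andP[/eqP kj _] /andP[/eqP lj _] kl.
by rewrite -[k]vsubmxK -[l]vsubmxK kj lj kl.
Qed.

Lemma uniq_fiber_dsubmx m n (s : seq 'cV[int]_(m + n)) j : uniq s ->
  uniq [seq usubmx k | k <- s & dsubmx k == j].
Proof.
move=> us; rewrite map_inj_in_uniq ?filter_uniq//.
move=> k l; rewrite !mem_filter => /andP[/eqP kj _] /andP[/eqP lj _] kl.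
by rewrite -[k]vsubmxK -[l]vsubmxK kj lj kl.
Qed.

Lemma size_cV1 (s : seq 'cV[int]_1) (x T : R) : uniq s -> 0 <= T ->
  (forall k, k \in s -> x <= (k 0 0)%:~R < x + T) -> (size s)%:R <= T + 1.
Proof.
move=> us T0 sx; rewrite -(size_map (fun k : 'cV[int]_1 => k 0 0)).
apply: (@size_int_itv _ x) => //.
  rewrite map_inj_uniq// => k l kl; apply/matrixP => i j.
  by rewrite !ord1.
by move=> _ /mapP[k ks ->]; exact: sx.
Qed.

Lemma size_int_cube n (s : seq 'cV[int]_n) (x : 'cV[R]_n) (T : R) :
  uniq s -> 0 <= T -> (forall k, k \in s -> in_cube x T (map_mx intr k)) ->
  (size s)%:R <= (T + 1) ^+ n.
Proof.
elim: n => [|n IH] in s x *.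
  move=> us T0 _; rewrite expr0 (ler_nat _ _ 1).
  apply: (@uniq_leq_size _ _ [:: 0]) => // k _.
  by rewrite mem_seq1; apply/eqP/matrixP => -[].
rewrite -[n.+1]/(1 + n)%N in s x * => us T0 sx.
have sx2 k : k \in s -> in_cube (usubmx x) T (map_mx intr (usubmx k)) &&
    in_cube (dsubmx x) T (map_mx intr (dsubmx k)).
  by move=> ks; rewrite -in_cube_col -col_mx_map_int; exact: sx.
rewrite exprS; apply: (@size_fibers _ _ _ usubmx).
- by rewrite exprn_ge0// addr_ge0.
- apply: (@size_cV1 _ (usubmx x 0 0)) => //; first exact: undup_uniq.
  move=> j; rewrite mem_undup => /mapP[k /sx2/andP[/in_cubeP/(_ 0) + _] ->].
  by rewrite mxE [map_mx _ _ _ _]mxE.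
- move=> j; rewrite -(size_map dsubmx); apply: (IH _ (dsubmx x)) => //.
    exact: uniq_fiber_usubmx.
  move=> k /mapP[l]; rewrite mem_filter => /andP[_ /sx2/andP[_ +]] ->.
  by [].
Qed.

(** The lattice [h Z^n] has upper density at most [d]. The factor [theta] and the
    additive constant [c] absorb all boundary effects, so that the property is
    stable under products and never needs asymptotic notation. *)
Definition sparse n (h : 'M[R]_n) (d : R) := forall theta : R, 1 < theta ->
  exists2 c : R, 0 <= c & forall (T : R) (x : 'cV[R]_n) (s : seq 'cV[int]_n),
    0 <= T -> uniq s -> (forall k, k \in s -> in_cube x T (h *m map_mx intr k)) ->
    (size s)%:R <= d * (theta * T + c) ^+ n.

Lemma sparse1 n : sparse (1%:M : 'M[R]_n) 1.
Proof.
move=> theta t1; exists 1 => // T x s T0 us sx.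
apply: (@le_trans _ _ ((T + 1) ^+ n)).
  by apply: (@size_int_cube _ _ x) => // k ks; rewrite -[map_mx _ _]mul1mx; exact: sx.
rewrite mul1r lerXn2r ?nnegrE; nra.
Qed.

Lemma sparse_row_perm n (p : 'S_n) (h : 'M[R]_n) d :
  sparse h d -> sparse (row_perm p h) d.
Proof.
move=> hd theta t1; have [c c0 hc] := hd _ t1.
exists c => // T x s T0 us sx.
apply: (hc _ (row_perm p^-1 x)) => // k /sx /in_cubeP kx.
apply/in_cubeP => i; have := kx ((p^-1)%g i).
rewrite row_permE -mulmxA -row_permE.
by rewrite !mxE permKV.
Qed.

(** The first coordinate of an integer vector is known up to [T + 1] choices; given
    it, the others are counted by [h] in a translated cube. *)
Lemma sparse_lblock n (c : 'cV[R]_n) (h : 'M[R]_n) d : 0 <= d -> sparse h d ->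
  sparse (block_mx 1 0 c h : 'M[R]_(1 + n)) d.
Proof.
move=> d0 hd theta t1; have [c0 c00 hc] := hd _ t1.
exists (c0 + 1); first by rewrite addr_ge0.
move=> T x s T0 us sx.
have sx2 k : k \in s -> in_cube (usubmx x) T (map_mx intr (usubmx k)) &&
    in_cube (dsubmx x) T (c *m map_mx intr (usubmx k) + h *m map_mx intr (dsubmx k)).
  move=> ks; rewrite -in_cube_col.
  have := sx _ ks; rewrite col_mx_map_int mul_block_col.
  by rewrite [1 *m _](_ : _ = map_mx intr (usubmx k)) ?mul0mx ?addr0// -[RHS]mul1mx.
apply: (@le_trans _ _ ((T + 1) * (d * (theta * T + c0) ^+ n))).
  apply: (@size_fibers _ _ _ usubmx).
  - by rewrite mulr_ge0// exprn_ge0// addr_ge0// mulr_ge0//; lra.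
  - apply: (@size_cV1 _ (usubmx x 0 0)) => //; first exact: undup_uniq.
    move=> j; rewrite mem_undup => /mapP[k /sx2/andP[/in_cubeP/(_ 0) + _] ->].
    by rewrite mxE [map_mx _ _ _ _]mxE.
  - move=> j; rewrite -(size_map dsubmx).
    apply: (hc _ (dsubmx x - c *m map_mx intr j)) => //.
      exact: uniq_fiber_usubmx.
    move=> k /mapP[l]; rewrite mem_filter => /andP[/eqP lj /sx2/andP[_ +]] ->.
    rewrite lj; move: (c *m _) (h *m _) => u w /in_cubeP H.
    by apply/in_cubeP => i; have := H i; rewrite !mxE; lra.
rewrite mulrCA ler_wpM2l// exprS ler_pM//.
- by rewrite addr_ge0.
- by rewrite exprn_ge0// addr_ge0// mulr_ge0//; lra.
- by nra.
- by rewrite lerXn2r ?nnegrE; nra.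
Qed.

(** Here the last coordinates are counted first, and the first one is then an
    integer in an interval of length [T / |a|]. *)
Lemma sparse_ublock n (a : R) (r : 'rV[R]_n) : a != 0 ->
  sparse (block_mx a%:M r 0 1%:M : 'M[R]_(1 + n)) `|a|^-1.
Proof.
move=> a0 theta t1; exists (`|a| + 1); first by rewrite addr_ge0.
move=> T x s T0 us sx; have na0 : 0 < `|a| by rewrite normr_gt0.
have sx2 k : k \in s -> in_cube (usubmx x) T
      (a%:M *m map_mx intr (usubmx k) + r *m map_mx intr (dsubmx k)) &&
    in_cube (dsubmx x) T (map_mx intr (dsubmx k)).
  move=> ks; rewrite -in_cube_col.
  have := sx _ ks; rewrite col_mx_map_int mul_block_col.
  by rewrite mul0mx add0r mul1mx.
apply: (@le_trans _ _ ((T + 1) ^+ n * (T / `|a| + 1))).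
  apply: (@size_fibers _ _ _ dsubmx).
  - by rewrite addr_ge0// divr_ge0.
  - apply: (@size_int_cube _ _ (dsubmx x)) => //; first exact: undup_uniq.
    by move=> j; rewrite mem_undup => /mapP[k /sx2/andP[_ +] ->].
  - move=> j; rewrite -(size_map usubmx).
    pose y := (usubmx x - r *m map_mx intr j) 0 0.
    have ay (k : 'cV[int]_1) :
        k \in [seq usubmx k | k <- s & dsubmx k == j] -> y <= a * (k 0 0)%:~R < y + T.
      move=> /mapP[l]; rewrite mem_filter => /andP[/eqP lj /sx2/andP[+ _]] ->.
      rewrite lj mul_scalar_mx /y; move: (r *m _) => u /in_cubeP/(_ 0).
      by rewrite !mxE; lra.
    rewrite -(size_map (fun k : 'cV[int]_1 => k 0 0)).
    apply: (@size_int_affine _ _ y) => //.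
      rewrite map_inj_uniq ?uniq_fiber_dsubmx// => k l kl.
      by apply/matrixP => i j'; rewrite !ord1.
    by move=> _ /mapP[k ks ->]; exact: ay.
have -> : T / `|a| + 1 = `|a|^-1 * (T + `|a|).
  by rewrite mulrDr mulVf ?gt_eqF// mulrC.
rewrite mulrCA ler_wpM2l ?invr_ge0// exprS mulrC ler_pM//.
- by rewrite addr_ge0.
- by rewrite exprn_ge0// addr_ge0.
- by nra.
- by rewrite lerXn2r ?nnegrE; nra.
Qed.


Definition entry_norm m n (A : 'M[R]_(m, n)) : R := \sum_i \sum_j `|A i j|.

Lemma entry_norm_ge0 m n (A : 'M[R]_(m, n)) : 0 <= entry_norm A.
Proof. by apply: sumr_ge0 => i _; apply: sumr_ge0. Qed.

Lemma mulmx_bound m n (A : 'M[R]_(m, n)) (r : 'cV[R]_n) (b : R) i : 0 <= b ->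
  (forall j, `|r j 0| <= b) -> `|(A *m r) i 0| <= entry_norm A * b.
Proof.
move=> b0 rb; rewrite mxE; apply: (le_trans (ler_norm_sum _ _ _)).
apply: (@le_trans _ _ (\sum_j `|A i j| * b)).
  by apply: ler_sum => j _; rewrite normrM ler_wpM2l.
rewrite -mulr_suml ler_wpM2r// /entry_norm [leRHS](bigD1 i)//= lerDl.
by apply: sumr_ge0 => k _; apply: sumr_ge0.
Qed.

(** Finitely many factors [t] may be lost on the way to a factor [theta]. *)
Lemma root_gt1 (theta : R) (n : nat) : 1 < theta ->
  exists2 t, 1 < t & t ^+ n <= theta.
Proof.
move=> t1; pose m := Num.min 1 (theta - 1).
have m0 : 0 < m by rewrite lt_min ltr01 subr_gt0.
have m1 : m <= 1 by rewrite ge_min lexx.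
have mt : m <= theta - 1 by rewrite ge_min lexx orbT.
have key (x : R) : 0 <= x <= 1 -> (1 + x) ^+ n <= 1 + 2 ^+ n * x.
  move=> /andP[x0 x1]; have : (1 + x) ^+ n <= 1 + (2 ^+ n - 1) * x.
    elim: n => [|n IH]; first by rewrite !expr0; lra.
    have p1 : 1 <= 2 ^+ n :> R by rewrite exprn_ege1// ler1n.
    rewrite !exprSr; move: (2 ^+ n) p1 IH => p p1 IH.
    have : (1 + x) ^+ n * (1 + x) <= (1 + (p - 1) * x) * (1 + x).
      by rewrite ler_wpM2r//; lra.
    have : (p - 1) * x * x <= (p - 1) * x by rewrite ler_piMr ?mulr_ge0 ?subr_ge0//; lra.
    by nra.
  by lra.
have p0 : 0 < 2 ^+ n :> R by rewrite exprn_gt0.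
have p1 : 1 <= 2 ^+ n :> R by rewrite exprn_ege1// ler1n.
exists (1 + m / 2 ^+ n); first by rewrite ltrDl divr_gt0.
apply: (le_trans (key _ _)).
  apply/andP; split; first by rewrite divr_ge0 ?(ltW m0) ?(ltW p0).
  by rewrite ler_pdivrMr// mul1r (le_trans m1).
by rewrite mulrC divfK ?gt_eqF//; lra.
Qed.

Lemma le_of_forall_root (a b : R) (n : nat) : 0 <= b ->
  (forall t, 1 < t -> a <= t ^+ n * b) -> a <= b.
Proof.
move=> b0 ab; apply/ler_addgt0Pr => e e0.
have [t t1 tn] := @root_gt1 (1 + e / (b + 1)) n (ltac:(rewrite ltrDl divr_gt0//; lra)).
apply: (le_trans (ab _ t1)); apply: (le_trans (ler_wpM2r b0 tn)).
rewrite mulrDl mul1r lerD2l -mulrA ler_piMr ?(ltW e0)//.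
by rewrite mulrC ler_pdivrMr; lra.
Qed.

Definition floor_vec n (S : R) (x : 'cV[R]_n) : 'cV[int]_n :=
  \col_i Num.floor (x i 0 / S).

Lemma in_cube_floor n (S : R) (x : 'cV[R]_n) : 0 < S ->
  in_cube (S *: map_mx intr (floor_vec S x)) S x.
Proof.
move=> S0; apply/in_cubeP => i; rewrite !mxE.
have /andP[] := floor_itv (x i 0 / S).
rewrite intrD ler_pdivlMr// ltr_pdivrMr// mulrDl mul1r [S * _]mulrC => -> ->.
by [].
Qed.

(** Group the integer vectors [k] by the cube of side [S] that contains [h2 k]. For
    large [S] a cube contains about [d2 S^n] of them. The matrix [h1] maps the corner
    [S j] of the cube to a point at distance at most [S * entry_norm h1] from
    [h1 h2 k], so that about [d1 (T / S)^n] cubes occur. *)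
Lemma sparseM n (h1 h2 : 'M[R]_n) d1 d2 : 0 <= d1 -> 0 <= d2 ->
  sparse h1 d1 -> sparse h2 d2 -> sparse (h1 *m h2) (d1 * d2).
Proof.
move=> d10 d20 sp1 sp2 theta /(@root_gt1 _ 3)[t t1 t3].
have [c1 c10 hc1] := sp1 _ t1; have [c2 c20 hc2] := sp2 _ t1.
(* chosen so that [t * S + c2] is at most [t ^+ 2 * S] *)
pose S := (c2 + 1) / (t * (t - 1)).
have tt0 : 0 < t * (t - 1) by nra.
have S0 : 0 < S by rewrite divr_gt0//; lra.
have Sc2 : t * S + c2 <= t ^+ 2 * S.
  have : t * (t - 1) * S = c2 + 1 by rewrite /S mulrC divfK// gt_eqF.
  by rewrite expr2; nra.
pose C := entry_norm h1; have C0 : 0 <= C by exact: entry_norm_ge0.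
exists (t ^+ 2 * S * (2 * t * C + c1)).
  by apply: mulr_ge0; [apply: mulr_ge0; [exact: sqr_ge0|lra]|nra].
move=> T x s T0 us sx.
pose f (k : 'cV[int]_n) := floor_vec S (h2 *m map_mx intr k).
have Si : 0 < S^-1 by rewrite invr_gt0.
have TS0 : 0 <= T / S by rewrite divr_ge0// ltW.
apply: (@le_trans _ _
    ((d1 * (t * (T / S + 2 * C) + c1) ^+ n) * (d2 * (t ^+ 2 * S) ^+ n))).
  apply: (@size_fibers _ _ _ f).
  - by rewrite mulr_ge0// exprn_ge0// mulr_ge0 ?sqr_ge0// ltW.
  - apply: (hc1 _ (S^-1 *: x - const_mx C)) => //.
    - by rewrite addr_ge0// mulr_ge0.
    - exact: undup_uniq.
    move=> j; rewrite mem_undup => /mapP[k ks ->].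
    pose r : 'cV[R]_n := S^-1 *: (h2 *m map_mx intr k) - map_mx intr (f k).
    have rE : h1 *m map_mx intr (f k) =
        S^-1 *: (h1 *m h2 *m map_mx intr k) - h1 *m r.
      by rewrite /r mulmxBr -scalemxAr mulmxA opprB addrC subrK.
    have rb i : `|(h1 *m r) i 0| <= C.
      rewrite -[C]mulr1; apply: mulmx_bound => // j'.
      have /in_cubeP/(_ j') := in_cube_floor (h2 *m map_mx intr k) S0.
      rewrite /r /f; move: (h2 *m _) (floor_vec _ _) => u w; rewrite !mxE.
      move=> /andP[/(ler_wpM2l (ltW Si)) a]; rewrite -(ltr_pM2l Si) mulrDr => b.
      move: a b; rewrite !mulKf ?mulVf ?gt_eqF// => a b.
      by rewrite ler_norml; lra.
    have /in_cubeP xk := sx _ ks.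
    rewrite rE; apply/in_cubeP => i; have := xk i; have := rb i.
    move: (h1 *m r) (_ *m map_mx intr k) => u w; rewrite !mxE ler_norml.
    move=> /andP[u1 u2] /andP[w1 w2].
    have := ler_wpM2l (ltW Si) w1; have := w2; rewrite -(ltr_pM2l Si) mulrDr.
    by move=> a b; apply/andP; split; lra.
  - move=> j; apply: (@le_trans _ _ (d2 * (t * S + c2) ^+ n)).
      apply: (hc2 _ (S *: map_mx intr j)); [lra|exact: filter_uniq|].
      move=> k; rewrite mem_filter => /andP[/eqP <- _].
      exact: in_cube_floor.
    rewrite ler_wpM2l// lerXn2r// nnegrE; first by nra.
    by rewrite mulr_ge0 ?sqr_ge0// ltW.
rewrite mulrACA -exprMn ler_wpM2l ?mulr_ge0//.
have -> : (t * (T / S + 2 * C) + c1) * (t ^+ 2 * S) =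
    t ^+ 3 * T + t ^+ 2 * S * (2 * t * C + c1).
  by field; rewrite gt_eqF.
have tS0 : 0 <= t ^+ 2 * S * (2 * t * C + c1).
  by apply: mulr_ge0; [apply: mulr_ge0; [exact: sqr_ge0|lra]|nra].
have t30 : 0 <= t ^+ 3 * T by rewrite mulr_ge0// exprn_ge0//; lra.
rewrite lerXn2r ?nnegrE//.
- by rewrite addr_ge0.
- by rewrite addr_ge0// mulr_ge0// (le_trans _ t3)// exprn_ge0//; lra.
- by rewrite lerD2r ler_wpM2r.
Qed.

(** Gaussian elimination: after a permutation of the rows the first pivot is
    nonzero, and the matrix is a product of the two kinds of block matrices above. *)
Lemma sparse_det n (h : 'M[R]_n) : \det h != 0 -> sparse h `|\det h|^-1.
Proof.
elim: n => [|n IH] in h *.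
  move=> _; rewrite det_mx00 normr1 invr1 (_ : h = 1%:M); first exact: sparse1.
  by apply/matrixP => -[].
rewrite -[n.+1]/(1 + n)%N in h * => dh.
have [i hi] : exists i, h i 0 != 0.
  apply/existsP; apply: contraNT dh; rewrite negb_exists => /forallP h0.
  rewrite (expand_det_col _ 0) big1// => i _.
  by have := h0 i; rewrite negbK => /eqP ->; rewrite mul0r.
pose p := tperm (0 : 'I_(1 + n)) i; pose g := row_perm p h.
have hg : h = row_perm p g by rewrite /g -row_permM tperm2 row_perm1.
have dg : `|\det g| = `|\det h|.
  by rewrite /g row_permE det_mulmx det_perm normrM normr_sign mul1r.
rewrite -dg hg; apply: sparse_row_perm.
pose a := g 0 0; pose r := ursubmx g; pose c := a^-1 *: dlsubmx g.
have a0 : a != 0 by rewrite /a /g mxE tpermL.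
pose h' := drsubmx g - c *m r.
have gE : g = block_mx 1 0 c h' *m block_mx a%:M r 0 1%:M.
  rewrite mulmx_block !mulmx0 !mul0mx !addr0 !mulmx1 [c *m a%:M]mul_mx_scalar.
  rewrite /c scalerA divff// scale1r /h' addrC subrK.
  rewrite [1 *m a%:M](_ : _ = a%:M); last exact: mul1mx.
  rewrite [1 *m r](_ : _ = r); last exact: mul1mx.
  rewrite -[LHS]submxK; congr block_mx.
  by apply/matrixP => x y; rewrite !ord1 [RHS]mxE eqxx mulr1n /a; move: (g) => g'; rewrite !mxE;
    congr (g' _ _); exact/val_inj.
have dgE : \det g = \det h' * a.
  by rewrite {1}gE det_mulmx det_lblock det_ublock !det1 mul1r mulr1 det_scalar1.
have dh'0 : \det h' != 0.
  apply: contraNneq dh => dh'0; rewrite -normr_eq0 -dg dgE dh'0 mul0r normr0.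
  exact: eqxx.
rewrite dgE normrM invfM {1}gE.
apply: sparseM; rewrite ?invr_ge0//; last exact: sparse_ublock.
by apply: sparse_lblock; [rewrite invr_ge0|exact: IH].
Qed.

End Counting.

(** * Cosets and the topology of the torus *)

(** All integrals over a torus that occur below are integrals of finite linear
    combinations of indicators, with coefficients of both signs. *)
Lemma prob_lin d (T : measurableType d) (R : realType) (P : probability T R)
    (I : Type) (r : seq I) (A : I -> set T) (a : I -> R) (B : set T) (c : R) :
    measurable B -> (forall i, measurable (A i)) ->
    (forall t, \1_B t <= c + \sum_(i <- r) a i * \1_(A i) t) ->
  fine (P B) <= c + \sum_(i <- r) a i * fine (P (A i)).
Proof.
move=> mB mA le1.
have finP C : measurable C -> (fine (P C))%:E = P C.
  by move=> mC; rewrite fineK// fin_num_measure.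
have intA i : P.-integrable setT (fun t => ((a i)%:E * (\1_(A i) t)%:E)%E).
  by apply: integrableZl => //; exact: integrable_indic.
have intS : P.-integrable setT
    (fun t => (\sum_(j <- r) ((a j)%:E * (\1_(A j) t)%:E))%E).
  by apply: integrable_sum.
have intc : P.-integrable setT (cst c%:E).
  by apply: finite_measure_integrable_cst.
rewrite -lee_fin EFinD -sumEFin finP//.
have -> : P B = (\int[P]_t (\1_B t)%:E)%E by rewrite integral_indic// setIT.
have -> : (c%:E + \sum_(i <- r) (a i * fine (P (A i)))%:E)%E =
   (\int[P]_t (cst c%:E t + \sum_(i <- r) ((a i)%:E * (\1_(A i) t)%:E)))%E.
  rewrite integralD//= integral_cst//; rewrite [X in (_ * X)%E]probability_setT mule1; congr (_ + _)%E.
  rewrite integral_sum//; apply: eq_bigr => i _.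
  by rewrite integralZl ?integrable_indic// integral_indic// setIT EFinM finP.
apply: le_integral => //.
- exact: integrable_indic.
- exact: integrableD.
- move=> t _; rewrite /cst /=.
  rewrite (eq_bigr (fun i => (a i * \1_(A i) t)%:E)) ?sumEFin -?EFinD ?lee_fin//.
Qed.

Section MatrixTopology.
Variable R : realType.

Lemma open_coord_box n (a b : 'cV[R]_n) :
  open [set y : 'cV[R]_n | forall i, a i 0 < y i 0 < b i 0].
Proof.
rewrite openE => y yab.
exists (fun i j => [set z | a i 0 < z < b i 0]).
  move=> i j; rewrite [j]ord1; have := yab i => /= yi.
  have : open `]a i 0, b i 0[%classic by exact: interval_open.
  rewrite openE => /(_ (y i 0)) /=; rewrite in_itv/= yi => /(_ isT).
  by apply: filterS => z /=; rewrite in_itv.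
by move=> z zab i; exact: (zab i 0).
Qed.

Lemma continuous_mx (S : topologicalType) m n (f : S -> 'M[R]_(m, n)) :
  (forall i j, continuous (fun s => f s i j)) -> continuous f.
Proof.
move=> fij s A [P Ps PA]; rewrite /nbhs/=.
apply: (@filterS _ (nbhs s) _ [set t | forall i j, P i j (f t i j)]).
  by move=> t Pt; exact: PA.
apply: (@filter_forall _ _ (fun i t => forall j, P i j (f t i j)) (nbhs s)) => i.
apply: (@filter_forall _ _ (fun j t => P i j (f t i j)) (nbhs s)) => j.
exact: (fij i j s _ (Ps i j)).
Qed.

Lemma continuous_translate n (c : 'cV[R]_n) : continuous (fun x : 'cV[R]_n => c + x).
Proof. by move=> x; apply: continuousD; [exact: cst_continuous|exact: (@cvg_id _ (nbhs x))]. Qed.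

End MatrixTopology.

Section TorusPoints.
Variables (R : realType) (n : nat) (L : lattice R n) (h : 'M[R]_n).
Hypothesis Lh : lattice_points L = lattice_of h.

Lemma torus_ext (t1 t2 : torus L) : torus_points t1 = torus_points t2 -> t1 = t2.
Proof.
case: t1 t2 => [T1 h1] [T2 h2] /= e; rewrite -e in h2 *.
by congr Torus; exact: Prop_irrelevance.
Qed.

Lemma torus_proj_eq (x y : 'cV[R]_n) :
  torus_proj L x = torus_proj L y <-> exists k, y = x + h *m map_mx intr k.
Proof.
split=> [/(congr1 (@torus_points R n L)) /= e|[k ->]].
  have : translate y L y by exists 0; rewrite ?addr0// Lh; exists 0; rewrite // map_mx0 mulmx0.
  by rewrite -e => -[v]; rewrite Lh => -[k _ <-] <-; exists k.
apply: torus_ext; rewrite /= Lh; apply/seteqP; split=> _ [_ [l _ <-] <-].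
  exists (h *m map_mx intr (l - k)); first by exists (l - k).
  by rewrite map_mxB mulmxBr addrAC -addrA subrK.
exists (h *m map_mx intr (l + k)); first by exists (l + k).
by rewrite map_mxD mulmxDr addrAC addrA.
Qed.

Lemma torus_projP (t : torus L) : exists x, t = torus_proj L x.
Proof.
by case: t => T [x e]; exists x; exact: torus_ext.
Qed.

Lemma torus_points_proj (x z : 'cV[R]_n) :
  torus_points (torus_proj L x) z <-> exists k, z = x + h *m map_mx intr k.
Proof.
rewrite /= /translate /= Lh; split=> [[_ [k _ <-] <-]|[k ->]]; first by exists k.
by exists (h *m map_mx intr k) => //; exists k.
Qed.

Lemma torus_add_proj (y x : 'cV[R]_n) :
  torus_add y (torus_proj L x) = torus_proj L (y + x).
Proof.
apply: torus_ext => /=.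
apply/seteqP; split=> [_ [_ [v Lv <-] <-]|_ [v Lv <-]].
  by exists v; rewrite // addrA.
by exists (x + v); [exists v | rewrite addrA].
Qed.

(** Events on the torus are described by the part of space that a coset meets. *)
Definition hits (A : set 'cV[R]_n) : set (borel_torus L) := torus_proj L @` A.

Lemma hitsP (A : set 'cV[R]_n) (t : torus L) :
  hits A t <-> exists2 z, A z & torus_points t z.
Proof.
have [x ->] := torus_projP t; split=> [[z Az zx]|[z Az /torus_points_proj[k zk]]].
  exists z => //; apply/torus_points_proj; apply: (torus_proj_eq x z).1.
  exact/esym.
by exists z => //; apply/esym; apply: (torus_proj_eq x z).2; exists k.
Qed.

Lemma hits_proj (A : set 'cV[R]_n) (x : 'cV[R]_n) :
  hits A (torus_proj L x) <-> exists k, A (x + h *m map_mx intr k).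
Proof.
split=> [/hitsP[z Az /torus_points_proj[k zk]]|[k Ak]]; first by exists k; rewrite -zk.
by apply/hitsP; exists (x + h *m map_mx intr k) => //; apply/torus_points_proj; exists k.
Qed.

Lemma measurable_hits_open A : open A -> measurable (hits A).
Proof.
move=> oA; apply: sub_sigma_algebra; rewrite /quotient_opens/=.
have -> : torus_proj L @^-1` hits A =
    \bigcup_(k in [set: 'cV[int]_n]) ((fun x => h *m map_mx intr k + x) @^-1` A).
  apply/seteqP; split=> x /=.
    by move=> /hits_proj[k Ak]; exists k => //=; rewrite addrC.
  by move=> [k _ /= Ak]; apply/hits_proj; exists k; rewrite addrC.
apply: bigcup_open => k _; apply: open_comp => // x _.
exact: continuous_translate.
Qed.

Lemma hits_translate (y : 'cV[R]_n) A :
  torus_add y @^-1` hits [set y + x | x in A] = hits A.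
Proof.
apply/seteqP; split=> t /=; have [x ->] := torus_projP t.
  rewrite torus_add_proj => /hits_proj[k [z Az]].
  by rewrite -addrA => /addrI zE; apply/hits_proj; exists k; rewrite -zE.
move=> /hits_proj[k Ak]; rewrite torus_add_proj; apply/hits_proj; exists k.
by exists (x + h *m map_mx intr k); rewrite // addrA.
Qed.

(** Choosing one point of the coset in each cell that it meets turns the sum of
    indicators into the size of a list of integer vectors. They are distinct because
    the cells are disjoint. *)
Lemma count_cells (I : eqType) (r : seq I) (cell : I -> set 'cV[R]_n)
    (x : 'cV[R]_n) :
    uniq r -> (forall i j z, cell i z -> cell j z -> i = j) ->
  exists s : seq 'cV[int]_n, [/\ uniq s,
    \sum_(i <- r) \1_(hits (cell i)) (torus_proj L x) = (size s)%:R :> R &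
    forall k, k \in s -> exists2 i, i \in r & cell i (x + h *m map_mx intr k)].
Proof.
move=> ur dis.
pose b i := torus_proj L x \in hits (cell i).
have /boolp.choice[kk kkP] i : exists k, b i -> cell i (x + h *m map_mx intr k).
  have [/set_mem/hits_proj[k ck]|nb] := boolP (b i); last by exists 0.
  by exists k.
exists [seq kk i | i <- r & b i]; split.
- rewrite map_inj_in_uniq ?filter_uniq// => i j.
  rewrite !mem_filter => /andP[bi _] /andP[bj _] kij.
  by apply: (dis _ _ (x + h *m map_mx intr (kk i))); [|rewrite kij]; exact: kkP.
- rewrite size_map size_filter -sum1_count natr_sum big_mkcond /=.
  by rewrite [RHS]big_mkcond/=; apply: eq_bigr => i _; rewrite indicE -/(b i); case: ifP.
- move=> k /mapP[i]; rewrite mem_filter => /andP[bi ir] ->.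
  by exists i => //; exact: kkP.
Qed.

End TorusPoints.

Arguments hits {R n} L A _.

(** * Haar measure of small cubes in the torus *)

Section Grids.
Variable R : realType.

Definition cube n (x : 'cV[R]_n) (T : R) : set 'cV[R]_n := [set y | in_cube x T y].

Lemma cube_translate n (x : 'cV[R]_n) T : cube x T = [set x + y | y in cube 0 T].
Proof.
apply/seteqP; split=> [y /in_cubeP xy|_ [y /in_cubeP xy <-]].
  exists (y - x); last by rewrite addrC subrK.
  by apply/in_cubeP => i; have := xy i; rewrite !mxE; lra.
by apply/in_cubeP => i; have := xy i; rewrite !mxE; lra.
Qed.

Lemma cube_diff n (x y z : 'cV[R]_n) T i :
  cube x T y -> cube x T z -> `|(y - z) i 0| < T.
Proof.
move=> /in_cubeP/(_ i) a /in_cubeP/(_ i) b; rewrite !mxE ltr_norml.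
by apply/andP; split; lra.
Qed.

Definition grid_pt n K (x : 'cV[R]_n) (s : R) (e : {ffun 'I_n -> 'I_K}) : 'cV[R]_n :=
  x + \col_i (s * (e i)%:R).

Lemma grid_cell_disjoint n K (x : 'cV[R]_n) s (e e' : {ffun 'I_n -> 'I_K}) z :
  0 < s -> cube (grid_pt x s e) s z -> cube (grid_pt x s e') s z -> e = e'.
Proof.
move=> s0 /in_cubeP ze /in_cubeP ze'; apply/ffunP => i; apply/val_inj/eqP.
have := ze i; have := ze' i; rewrite !mxE => /andP[a b] /andP[c d].
rewrite eqn_leq; apply/andP; split; rewrite -ltnS -(ltr_nat R) -addn1 natrD
  -(ltr_pM2l s0) mulrDr mulr1; lra.
Qed.

Lemma grid_cell_sub n K (x : 'cV[R]_n) s (e : {ffun 'I_n -> 'I_K}) :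
  0 < s -> cube (grid_pt x s e) s `<=` cube x (s * K%:R).
Proof.
move=> s0 z /in_cubeP ze; apply/in_cubeP => i; have := ze i; rewrite !mxE.
have : s * (e i).+1%:R <= s * K%:R by rewrite ler_pM2l// ler_nat.
have : 0 <= s * (e i)%:R by rewrite mulr_ge0// ltW.
by rewrite -[(e i).+1]addn1 natrD mulrDr mulr1; lra.
Qed.

Lemma sum_grid_const n K (c : R) :
  \sum_(e : {ffun 'I_n -> 'I_K}) c = K%:R ^+ n * c.
Proof. by rewrite sumr_const -natrX mulr_natl card_ffun !card_ord. Qed.

Lemma int_box_seq n (h : 'M[R]_n) (b : R) : h \in unitmx ->
  exists2 s : seq 'cV[int]_n, uniq s &
    forall k, (forall i, `|(h *m map_mx intr k) i 0| <= b) -> k \in s.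
Proof.
move=> hu; pose M := (Num.truncn (entry_norm (invmx h) * Num.max b 0)).+1.
have /finite_seqP[s sE] := finite_int_box n M.
exists (undup s); rewrite ?undup_uniq// => k kb; rewrite mem_undup.
change ([set` s] k); rewrite -sE /= => i.
rewrite -(ler_int R) intr_norm.
have -> : (k i 0)%:~R = (invmx h *m (h *m map_mx intr k)) i 0 :> R.
  by rewrite mulKmx// mxE.
apply: (@le_trans _ _ (entry_norm (invmx h) * Num.max b 0)).
  apply: mulmx_bound; first by rewrite le_max lexx orbT.
  by move=> j; rewrite le_max kb.
by rewrite ltW// truncnS_gt.
Qed.

End Grids.

Section TorusMeasure.
Variables (R : realType) (n : nat) (L : lattice R n) (h : 'M[R]_n).
Hypothesis Lh : lattice_points L = lattice_of h.
Hypothesis dh : \det h = 1.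

Let hu : h \in unitmx. Proof. by rewrite unitmxE dh unitr1. Qed.

(** Sup-norm balls of radius [T / 2] then embed into the torus. *)
Definition small (T : R) := forall k : 'cV[int]_n,
  (forall i, `|(h *m map_mx intr k) i 0| < T) -> k = 0.

Lemma small_le T T' : T <= T' -> small T' -> small T.
Proof. by move=> TT' sT k kT; apply: sT => i; apply: lt_le_trans TT'. Qed.

Lemma exists_small : exists2 T, 0 < T & small T.
Proof.
pose C := entry_norm (invmx h); have C0 : 0 <= C by exact: entry_norm_ge0.
exists (C + 1)^-1 => [|k kT]; first by rewrite invr_gt0; lra.
apply/matrixP => i j; rewrite [j]ord1 mxE.
suff : `|k i 0| < 1 by move: (k i 0) => -[[|m]|[|m]].
rewrite -(ltr_int R) intr_norm.
have -> : (k i 0)%:~R = (invmx h *m (h *m map_mx intr k)) i 0 :> R.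
  by rewrite mulKmx// mxE.
apply: (@le_lt_trans _ _ (C * (C + 1)^-1)).
  by apply: mulmx_bound => [|l]; [rewrite invr_ge0; lra|exact: ltW].
by rewrite ltr_pdivrMr; lra.
Qed.

(** The projection of an open set is open, hence measurable. A half-open cube is a
    decreasing intersection of open boxes, and because these boxes embed into the
    torus, projection commutes with the intersection. *)
Lemma measurable_cube (x : 'cV[R]_n) (T : R) : 0 < T -> small (2 * T) ->
  measurable (hits L (cube x T)).
Proof.
move=> T0 sT.
pose O (m : nat) := [set y : 'cV[R]_n | forall i,
  (x - const_mx (T / m.+1%:R)) i 0 < y i 0 < (x + const_mx T) i 0].
have OE m y : O m y <-> forall i, x i 0 - T / m.+1%:R < y i 0 < x i 0 + T.
  by split=> H i; have := H i; rewrite !mxE.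
have -> : hits L (cube x T) = \bigcap_m hits L (O m).
  apply/seteqP; split=> [_ [y /in_cubeP xy <-] m _|t tO].
    exists y => //; apply/OE => i; have := xy i.
    have : 0 < T / m.+1%:R by rewrite divr_gt0.
    by move: (T / _) => w; lra.
  have [y0 y0O y0t] := tO 0%N I.
  exists y0 => //; apply/in_cubeP => i.
  have [-> ->] : x i 0 <= y0 i 0 /\ y0 i 0 < x i 0 + T; last by [].
  split; last by have /OE/(_ i)/andP[] := y0O.
  rewrite leNgt; apply/negP => yx.
  pose m := Num.truncn (T / (x i 0 - y0 i 0)).
  have [y yO] := tO m I; rewrite -y0t => /esym/(torus_proj_eq Lh)[k yk].
  have k0 : k = 0.
    apply: sT => j; have -> : h *m map_mx intr k = y - y0 by rewrite yk addrC addKr.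
    have /OE/(_ j) := yO; have /OE/(_ j) := y0O; rewrite !mxE.
    have : T / m.+1%:R <= T by rewrite ler_pdivrMr// ler_peMr// ?(ltW T0)// ler1n.
    rewrite divr1; move: (T / _) => w a /andP[b c] /andP[d e]; rewrite ltr_norml.
    by apply/andP; split; lra.
  have yy : y = y0 by rewrite yk k0 map_mx0 mulmx0 addr0.
  have /OE/(_ i)/andP[+ _] := yO; rewrite yy ltNge => /negP; apply.
  have mT : T / (x i 0 - y0 i 0) < m.+1%:R by exact: truncnS_gt.
  have : T / m.+1%:R < x i 0 - y0 i 0.
    by rewrite ltr_pdivrMr// mulrC -ltr_pdivrMr// subr_gt0.
  by move: (T / _) => w; lra.
apply: bigcap_measurable => // m _; apply: (measurable_hits_open Lh).
exact: open_coord_box.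
Qed.

Variable nu : probability (borel_torus L) R.
Hypothesis nuH : torus_haar nu.

Lemma nu_cube_translate (x : 'cV[R]_n) (T : R) : 0 < T -> small (2 * T) ->
  nu (hits L (cube x T)) = nu (hits L (cube 0 T)).
Proof.
move=> T0 sT; rewrite cube_translate -(nuH x); first by rewrite (hits_translate Lh).
by rewrite -cube_translate; exact: measurable_cube.
Qed.

(** Distinct cells of the grid cannot both be met, as the whole cube embeds. *)
Lemma sum_hits_grid_le1 K (x : 'cV[R]_n) s t : 0 < s -> small (2 * (s * K%:R)) ->
  \sum_(e : {ffun 'I_n -> 'I_K}) \1_(hits L (cube (grid_pt x s e) s)) t
    <= \1_(hits L (cube x (s * K%:R))) t :> R.
Proof.
move=> s0 sK; have [y ->] := torus_projP t.
have [r [ur -> rP]] := @count_cells R n L h Lh _ (index_enum {ffun 'I_n -> 'I_K})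
  (fun e => cube (grid_pt x s e) s) y (index_enum_uniq _)
  (fun e e' z => @grid_cell_disjoint R n K x s e e' z s0).
have rc k : k \in r -> cube x (s * K%:R) (y + h *m map_mx intr k).
  by move=> /rP[e _]; exact: grid_cell_sub.
have r1 : (size r <= 1)%N.
  case: r ur rc {rP} => [|k [|l r]]//= /and3P[+ _ _] rc.
  rewrite inE negb_or => /andP[/negP[]]; rewrite -subr_eq0; apply/eqP/sK => i.
  rewrite map_mxB mulmxBr.
  have lr : l \in [:: k, l & r] by rewrite !inE eqxx orbT.
  have := cube_diff i (rc k (mem_head _ _)) (rc l lr).
  rewrite opprD addrACA subrr add0r => /lt_le_trans; apply.
  have : 0 <= s * K%:R by rewrite mulr_ge0// ltW.
  by lra.
rewrite indicE; case: r ur rc {rP} r1 => [|k [|//]] _ rc _; first by rewrite ler0n.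
rewrite ler_nat lt0b mem_set//; apply/(hits_proj Lh); exists k.
by apply: rc; exact: mem_head.
Qed.

(** The mean number of points of a coset in a large cube, computed with a grid of
    side [T], is the measure of one cell times the number of cells; and every coset
    obeys the upper bound for the density of [h Z^n]. *)
Lemma nu_cube_le (T : R) : 0 < T -> small (2 * T) ->
  fine (nu (hits L (cube 0 T))) <= T ^+ n.
Proof.
move=> T0 sT; apply: (@le_of_forall_root _ _ _ n); first by rewrite exprn_ge0// ltW.
move=> t /(@root_gt1 _ _ 2)[u u1 u2].
have dh0 : \det h != 0 by rewrite dh oner_eq0.
have [c c0 hc] := sparse_det dh0 u1.
move: hc; rewrite dh normr1 invr1 => hc.
pose K := (Num.truncn (c / ((u - 1) * T))).+1.
have uT0 : 0 < (u - 1) * T by rewrite mulr_gt0// subr_gt0.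
have K0 : 0 < K%:R :> R by rewrite ltr0n.
have cK : c <= (u - 1) * T * K%:R.
  by rewrite mulrC -ler_pdivrMr// ltW// truncnS_gt.
pose A (e : {ffun 'I_n -> 'I_K}) := hits L (cube (grid_pt 0 T e) T).
have mA e : measurable (A e) by exact: measurable_cube.
have le1 t' : \1_set0 t' <= (u * (T * K%:R) + c) ^+ n + \sum_e (- 1) * \1_(A e) t'.
  rewrite indicE in_set0 -mulr_sumr mulN1r subr_ge0.
  have [y ->] := torus_projP t'.
  have [r [ur -> rP]] := @count_cells R n L h Lh _ (index_enum {ffun 'I_n -> 'I_K})
    (fun e => cube (grid_pt 0 T e) T) y (index_enum_uniq _)
    (fun e e' z => @grid_cell_disjoint R n K 0 T e e' z T0).
  rewrite -[X in _ <= X]mul1r; apply: (hc _ (- y)) => //.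
    by rewrite mulr_ge0// ltW.
  move=> k /rP[e _ /(grid_cell_sub T0)/in_cubeP ye]; apply/in_cubeP => i.
  by have := ye i; rewrite !mxE; lra.
have := prob_lin nu measurable0 mA le1.
rewrite measure0 -mulr_sumr (eq_bigr (fun=> fine (nu (hits L (cube 0 T))))); last first.
  by move=> e _; rewrite /A nu_cube_translate.
rewrite sum_grid_const mulN1r subr_ge0 => Kp.
rewrite -(ler_pM2l (exprn_gt0 n K0)); apply: (le_trans Kp).
rewrite -!exprMn lerXn2r ?nnegrE//.
- by rewrite addr_ge0// !mulr_ge0//; lra.
- by rewrite !mulr_ge0 ?(le_trans _ u2) ?sqr_ge0 ?(ltW T0) ?(ltW K0).
- apply: (@le_trans _ _ ((2 * u - 1) * (T * K%:R))).
    have -> : (2 * u - 1) * (T * K%:R) = u * (T * K%:R) + (u - 1) * T * K%:R by ring.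
    by rewrite lerD2l.
  have -> : K%:R * (t * T) = t * (T * K%:R) by ring.
  rewrite ler_wpM2r ?mulr_ge0 ?(ltW T0)//.
  by move: u2; rewrite expr2; nra.
Qed.

(** Superadditivity transfers the bound for tiny cubes, where the boundary effects
    of [nu_cube_cover] vanish, to all small cubes. *)
Lemma nu_cube_grid K (s : R) : (0 < K)%N -> 0 < s -> small (2 * (s * K%:R)) ->
  K%:R ^+ n * fine (nu (hits L (cube 0 s))) <= fine (nu (hits L (cube 0 (s * K%:R)))).
Proof.
move=> K0 s0 sK.
have sKs : small (2 * s).
  by apply: small_le sK; rewrite ler_pM2l// ler_peMr ?(ltW s0)// ler1n.
have K0' : 0 < K%:R :> R by rewrite ltr0n.
pose A (o : option {ffun 'I_n -> 'I_K}) := if o is Some e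
  then hits L (cube (grid_pt 0 s e) s) else hits L (cube 0 (s * K%:R)).
pose a (o : option {ffun 'I_n -> 'I_K}) : R := if o is Some e then -1 else 1.
have mA o : measurable (A o).
  by case: o => [e|]; apply: measurable_cube => //; rewrite mulr_gt0.
have := @prob_lin _ _ R nu _ (None :: map Some (index_enum _)) A a set0 0 measurable0 mA.
rewrite measure0 big_cons big_map /= mul1r add0r.
rewrite (eq_bigr (fun=> - fine (nu (hits L (cube 0 s))))); last first.
  by move=> e _; rewrite nu_cube_translate// mulN1r.
rewrite sum_grid_const mulrN subr_ge0; apply => t.
rewrite indicE in_set0 add0r big_cons big_map /= mul1r -mulr_sumr mulN1r subr_ge0.
exact: sum_hits_grid_le1.
Qed.

(** A fundamental parallelepiped is covered by the cubes [s (j + [0, 1)^n)] that it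
    meets. These [j] are integer vectors for which [h^-1 j] lies in a cube of side
    about [1 / s], so the density bound for [h^-1 Z^n] limits their number. *)
Lemma nu_cube_cover (theta : R) : 1 < theta -> exists2 c, 0 <= c &
  forall s, 0 < s -> small (2 * s) ->
    s ^+ n <= fine (nu (hits L (cube 0 s))) * (theta + c * s) ^+ n.
Proof.
move=> theta1; pose g := invmx h.
have dg : \det g = 1 by rewrite /g det_inv dh invr1.
have dg0 : \det g != 0 by rewrite dg oner_eq0.
have gu : g \in unitmx by rewrite unitmx_inv.
have [c c0 hc] := sparse_det dg0 theta1.
move: hc; rewrite dg normr1 invr1 => hc.
pose C := entry_norm g; have C0 : 0 <= C by exact: entry_norm_ge0.
exists (theta * (2 * C) + c).
  by rewrite addr_ge0// !mulr_ge0//; lra.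
move=> s s0 ss; have si0 : 0 < s^-1 by rewrite invr_gt0.
have side0 : 0 <= s^-1 + 2 * C by rewrite addr_ge0 ?mulr_ge0 ?(ltW si0).
pose x0 : 'cV[R]_n := - const_mx C.
have [J0 uJ0 J0P] := int_box_seq (s^-1 + 3 * C) gu.
pose J := [seq j <- J0 | in_cube x0 (s^-1 + 2 * C) (g *m map_mx intr j)].
have szJ : (size J)%:R <= 1 * (theta * (s^-1 + 2 * C) + c) ^+ n.
  apply: (hc _ x0) => //; first exact: filter_uniq.
  by move=> k; rewrite mem_filter => /andP[].
pose A (j : 'cV[int]_n) := hits L (cube (s *: map_mx intr j) s).
have mA j : measurable (A j) by exact: measurable_cube.
have cov t : \1_[set: borel_torus L] t <= 0 + \sum_(j <- J) 1 * \1_(A j) t :> R.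
  rewrite indicT add0r -mulr_sumr mul1r /=.
  have [x1 ->] := torus_projP t.
  pose y := g *m x1; pose f := floor_vec 1 y.
  pose x := h *m (y - map_mx intr f).
  have xx1 : torus_proj L x1 = torus_proj L x.
    apply/(torus_proj_eq Lh); exists (- f).
    by rewrite /x mulmxBr /y /g mulKVmx// map_mxN mulmxN.
  have yf i : 0 <= (y - map_mx intr f) i 0 < 1.
    have /in_cubeP/(_ i) := in_cube_floor y (ltr01 : 0 < 1 :> R).
    by rewrite -/f scale1r; move: (map_mx intr f) => w; rewrite !mxE; lra.
  pose j := floor_vec s x.
  have xj : in_cube (s *: map_mx intr j) s x by exact: in_cube_floor.
  pose r := s^-1 *: x - map_mx intr j.
  have gj : g *m map_mx intr j = s^-1 *: (y - map_mx intr f) - g *m r.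
    by rewrite /r mulmxBr -scalemxAr /x /g mulKmx// opprB addrC subrK.
  have gr i : `|(g *m r) i 0| <= C.
    rewrite -[C]mulr1; apply: mulmx_bound => // i'.
    have /in_cubeP/(_ i') := xj; rewrite /r; move: (map_mx intr j) (x) => w u.
    rewrite !mxE => /andP[/(ler_wpM2l (ltW si0)) a].
    rewrite -(ltr_pM2l si0) mulrDr => b.
    move: a b; rewrite !mulKf ?mulVf ?gt_eqF// => a b.
    by rewrite ler_norml; lra.
  have gj_cube i : - C <= (g *m map_mx intr j) i 0 < s^-1 + C.
    rewrite gj; have := yf i; have := gr i; rewrite ler_norml.
    move: (g *m r) (y - _) => u w; rewrite !mxE => /andP[u1 u2] /andP[w1 w2].
    have := w2; rewrite -(ltr_pM2l si0) mulr1 => w3.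
    have : 0 <= s^-1 * w i 0 by rewrite mulr_ge0// ltW.
    by move=> w4; apply/andP; split; lra.
  have jJ : j \in J.
    rewrite mem_filter; apply/andP; split.
      by apply/in_cubeP => i; have := gj_cube i; rewrite /x0 !mxE; lra.
    apply: J0P => i; have := gj_cube i; rewrite ler_norml => /andP[a b].
    by apply/andP; split; lra.
  rewrite (bigD1_seq j)//= ?filter_uniq// indicE mem_set; last first.
    by rewrite xx1; exists x.
  by rewrite lerDl; apply: sumr_ge0 => i _; rewrite indicE.
have := prob_lin nu measurableT mA cov.
rewrite probability_setT add0r /=.
rewrite (eq_bigr (fun=> fine (nu (hits L (cube 0 s))))); last first.
  by move=> j _; rewrite mul1r /A nu_cube_translate.
rewrite big_const_seq count_predT iter_addr addr0 => le1.
have p0 : 0 <= fine (nu (hits L (cube 0 s))) by exact: fine_ge0.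
have {le1 szJ} : 1 <= (theta * (s^-1 + 2 * C) + c) ^+ n * fine (nu (hits L (cube 0 s))).
  apply: (le_trans le1); rewrite -[leLHS]mulr_natl ler_wpM2r//.
  by move: szJ; rewrite mul1r.
move=> /(ler_wpM2l (exprn_ge0 n (ltW s0))) H; move: H.
have <- : s * (theta * (s^-1 + 2 * C) + c) = theta + (theta * (2 * C) + c) * s.
  by field; rewrite gt_eqF.
by rewrite mulr1 exprMn => H; rewrite mulrC -mulrA.
Qed.

(** Up to factors close to 1 the lower bound follows from [nu_cube_grid] and
    [nu_cube_cover], for a fine subdivision of the cube. *)
Lemma nu_cube (x : 'cV[R]_n) (T : R) : 0 < T -> small (2 * T) ->
  fine (nu (hits L (cube x T))) = T ^+ n.
Proof.
move=> T0 sT; rewrite nu_cube_translate//; apply/eqP; rewrite eq_le nu_cube_le//=.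
apply: (@le_of_forall_root _ _ _ n); first exact: fine_ge0.
move=> t t1; have u1 : 1 < (1 + t) / 2 by lra.
have [c c0 hc] := nu_cube_cover u1.
pose K := (Num.truncn (c * T / ((t - 1) / 2))).+1.
have K0 : 0 < K%:R :> R by rewrite ltr0n.
have tt0 : 0 < (t - 1) / 2 by lra.
have cK : c * (T / K%:R) <= (t - 1) / 2.
  by rewrite mulrA ler_pdivrMr// [leRHS]mulrC -ler_pdivrMr// ltW// truncnS_gt.
have s0 : 0 < T / K%:R by rewrite divr_gt0.
have TE : T = T / K%:R * K%:R by rewrite divfK// gt_eqF.
have ss : small (2 * (T / K%:R)).
  by apply: small_le sT; rewrite ler_pM2l// ler_pdivrMr// ler_peMr ?(ltW T0)// ler1n.
have grid := @nu_cube_grid K (T / K%:R) (ltn0Sn _) s0 (ltac:(by rewrite -TE)).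
rewrite -TE in grid.
have p0 : 0 <= fine (nu (hits L (cube 0 (T / K%:R)))) by exact: fine_ge0.
apply: (@le_trans _ _ (K%:R ^+ n * (fine (nu (hits L (cube 0 (T / K%:R)))) * t ^+ n))).
  rewrite {1}TE exprMn mulrC ler_wpM2l ?exprn_ge0 ?(ltW K0)//.
  apply: (le_trans (hc _ s0 ss)); rewrite ler_wpM2l// lerXn2r ?nnegrE//.
  - by rewrite addr_ge0// ?mulr_ge0 ?(ltW s0)//; lra.
  - by lra.
  - by lra.
by rewrite mulrA mulrC ler_wpM2l// exprn_ge0//; lra.
Qed.

End TorusMeasure.

(** * Volume and the covering bound *)

Section Volume.
Variables (R : realType) (n : nat).

Definition box_volume (a b : 'cV[R]_n) : R := \prod_i (b i 0 - a i 0).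

Lemma box_volume_ge0 (a b : 'cV[R]_n) : (forall i, a i 0 <= b i 0) -> 0 <= box_volume a b.
Proof. by move=> ab; apply: prodr_ge0 => i _; rewrite subr_ge0. Qed.

Lemma volume_le_boxes (r : seq ('cV[R]_n * 'cV[R]_n)) (A : set 'cV[R]_n) : (0 < n)%N ->
    (forall p, p \in r -> forall i, p.1 i 0 <= p.2 i 0) ->
    (forall x, A x -> exists2 p, p \in r & box p.1 p.2 x) ->
  (volume A <= (\sum_(p <- r) box_volume p.1 p.2)%:E)%E.
Proof.
move=> n0 rle rA; apply: ereal_inf_lbound.
exists (fun k => (nth (0, 0) r k).1), (fun k => (nth (0, 0) r k).2); split.
- move=> k i; have [kr|kr] := ltnP k (size r); first by apply: rle; exact: mem_nth.
  by rewrite nth_default.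
- move=> x /rA[p pr px]; exists (index p r) => //.
  by rewrite nth_index.
- have -> : (\sum_(p <- r) box_volume p.1 p.2)%:E =
      (\sum_(0 <= k < size r) (box_volume (nth (0, 0) r k).1 (nth (0, 0) r k).2)%:E)%E.
    by rewrite sumEFin (big_nth (0, 0)).
  rewrite (nneseries_split 0 (size r)); last first.
    move=> k _; rewrite lee_fin; apply: box_volume_ge0 => i.
    have [kr|kr] := ltnP k (size r); first by apply: rle; exact: mem_nth.
    by rewrite nth_default.
  rewrite add0n [X in (_ + X)%E]eseries0 ?adde0// => k kr _.
  rewrite nth_default// (bigD1 (Ordinal n0))//= mxE subrr mul0r//.
Qed.

Lemma volume_scale (r : R) (A B : set 'cV[R]_n) : 0 < r ->
  (forall x, B x -> A (r^-1 *: x)) -> (volume B <= (r ^+ n)%:E * volume A)%E.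
Proof.
move=> r0 BA; have rn0 : 0 < r ^+ n by rewrite exprn_gt0.
rewrite -lee_pdivrMl//; apply/ereal_infP => _ [a [b [ab Acov ->]]].
rewrite lee_pdivrMl// -nneseriesZl; last first.
  by move=> k _; rewrite lee_fin; exact: box_volume_ge0.
apply: ereal_inf_lbound.
exists (fun k => r *: a k), (fun k => r *: b k); split.
- by move=> k i; rewrite !mxE ler_pM2l.
- move=> x /BA/Acov[k _ xk]; exists k => // i; have := xk i.
  by rewrite !mxE mulrC ler_pdivlMr// ler_pdivrMr// ![r * _]mulrC.
- apply: eq_eseriesr => k _; rewrite -EFinM; congr EFin.
  rewrite [RHS](eq_bigr (fun i => r * (b k i 0 - a k i 0))); last first.
    by move=> i _; rewrite !mxE mulrBr.
  by rewrite big_split/= prodr_const card_ord.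
Qed.

Lemma enorm_ge0 (x : 'cV[R]_n) : 0 <= enorm x.
Proof. exact: sqrtr_ge0. Qed.

Lemma enorm_scale (c : R) (x : 'cV[R]_n) : 0 <= c -> enorm (c *: x) = c * enorm x.
Proof.
move=> c0; rewrite /enorm -[c in RHS]ger0_norm// -sqrtr_sqr -sqrtrM ?sqr_ge0//.
by congr Num.sqrt; rewrite mulr_sumr; apply: eq_bigr => i _; rewrite !mxE exprMn.
Qed.

Lemma volume_unit_ball : (0 < n)%N ->
  volume [set x : 'cV[R]_n | enorm x <= 1] = (kappa R n)%:E.
Proof.
move=> n0; rewrite /kappa fineK// ge0_fin_numE; last first.
  apply/ereal_infP => _ [a [b [ab _ ->]]]; apply: nneseries_ge0 => k _ _.
  by rewrite lee_fin; exact: box_volume_ge0.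
apply: (@le_lt_trans _ _ (\sum_(p <- [:: (const_mx (-1), const_mx 1)]) box_volume p.1 p.2)%:E).
  apply: volume_le_boxes => //.
    by move=> p; rewrite mem_seq1 => /eqP -> i; rewrite !mxE; lra.
  move=> x /= x1; eexists; first exact: mem_head.
  move=> i; rewrite !mxE /= -ler_norml; exact: (le_trans (ler_enorm x i) x1).
exact: ltry.
Qed.

Lemma volume_ball_le (r : R) : (0 < n)%N -> 0 < r ->
  (volume [set x : 'cV[R]_n | (enorm x <= r)%R] <= (kappa R n * r ^+ n)%:E)%E.
Proof.
move=> n0 r0; rewrite mulrC EFinM -volume_unit_ball//; apply: volume_scale => // x /=.
by move=> xr; rewrite enorm_scale ?invr_ge0 ?(ltW r0)// mulrC ler_pdivrMr// mul1r.
Qed.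

Lemma volume_ball_ge (r : R) : (0 < n)%N -> 0 < r ->
  ((kappa R n * r ^+ n)%:E <= volume [set x : 'cV[R]_n | (enorm x <= r)%R])%E.
Proof.
move=> n0 r0; rewrite mulrC EFinM -volume_unit_ball//.
have rn0 : 0 < r ^+ n by rewrite exprn_gt0.
rewrite muleC -lee_pdivlMr// muleC -exprVn; apply: volume_scale; rewrite ?invr_gt0//.
by move=> x /= x1; rewrite invrK enorm_scale ?(ltW r0)// -[leRHS]mulr1 ler_pM2l.
Qed.

End Volume.

(** A quantitative form of continuity: boxes may be enlarged at a linear cost. *)
Lemma prod_add_small (R : realType) (I : Type) (r : seq I) (l : I -> R) :
    (forall i, 0 <= l i) ->
  exists2 D, 0 <= D & forall s, 0 <= s -> s <= 1 ->
    \prod_(i <- r) (l i + s) <= \prod_(i <- r) l i + s * D.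
Proof.
move=> l0; elim: r => [|i r [D D0 IH]].
  by exists 0 => // s _ _; rewrite !big_nil mulr0 addr0.
have P0 : 0 <= \prod_(i <- r) l i by apply: prodr_ge0.
exists (l i * D + \prod_(i <- r) l i + D).
  by rewrite !addr_ge0// mulr_ge0.
move=> s s0 s1; rewrite !big_cons.
apply: (@le_trans _ _ ((l i + s) * (\prod_(j <- r) l j + s * D))).
  by rewrite ler_wpM2l ?addr_ge0// IH.
have sD : 0 <= s * D by rewrite mulr_ge0.
have : s * (s * D) <= s * D by rewrite ler_piMl.
by move: (\prod_(_ <- _) _) => P; rewrite !mulrDl !mulrDr; lra.
Qed.

Section CoveringBound.
Variables (R : realType) (n : nat) (L : lattice R n) (h : 'M[R]_n).
Hypothesis Lh : lattice_points L = lattice_of h.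
Hypothesis dh : \det h = 1.
Variable nu : probability (borel_torus L) R.
Hypothesis nuH : torus_haar nu.

(** Tile the box by cubes of side [s]. *)
Lemma hits_box_le (a b : 'cV[R]_n) (s : R) : 0 < s -> small h (2 * s) ->
    (forall i, a i 0 <= b i 0) ->
  exists E : set (borel_torus L), [/\ measurable E, hits L (box a b) `<=` E &
    (nu E <= (\prod_i (b i 0 - a i 0 + s))%:E)%E].
Proof.
move=> s0 ss ab; pose N i := (Num.truncn ((b i 0 - a i 0) / s)).+1.
pose J := {dffun forall i : 'I_n, 'I_(N i)}.
pose c (e : J) : 'cV[R]_n := \col_i (a i 0 + s * (e i : nat)%:R).
pose A e := hits L (cube (c e) s).
have mA e : measurable (A e) by exact: (measurable_cube Lh).
pose E := \bigcup_(e in [set: J]) A e.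
have mE : measurable E.
  by apply: fin_bigcup_measurable => [|e _]; [exact: finite_finset|exact: mA].
exists E; split => //.
  move=> _ [x xab <-].
  have q0 i : 0 <= (x i 0 - a i 0) / s.
    by rewrite divr_ge0 ?(ltW s0)// subr_ge0; case/andP: (xab i).
  have eN i : (Num.truncn ((x i 0 - a i 0) / s)%R < N i)%N.
    rewrite ltnS; apply: le_truncn; rewrite ler_pM2r ?invr_gt0// lerD2r.
    by case/andP: (xab i).
  exists [ffun i => Ordinal (eN i)] => //; exists x => //.
  apply/in_cubeP => i; rewrite !mxE ffunE /=.
  have /andP[] := truncn_itv (q0 i); move: (Num.truncn _) => t.
  by rewrite -[t.+1]addn1 natrD ler_pdivlMr// ltr_pdivrMr// mulrDl mul1r [_ * s]mulrC; lra.
have := @prob_lin _ _ R nu _ (index_enum J) A (fun=> 1) E 0 mE mA.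
move=> H; rewrite -[leLHS]fineK ?fin_num_measure// lee_fin; apply: (le_trans (H _)).
  move=> t; rewrite add0r -mulr_sumr mul1r indicE.
  have [/set_mem[e _ Ae]|_] := boolP (t \in E); last first.
    by apply: sumr_ge0 => e _; rewrite indicE.
  rewrite (bigD1 e)//= indicE mem_set// lerDl.
  by apply: sumr_ge0 => i _; rewrite indicE.
rewrite add0r [leLHS](eq_bigr (fun=> s ^+ n)); last first.
  by move=> e _; rewrite mul1r /A (nu_cube Lh).
rewrite sumr_const card_dep_ffun.
have -> : foldr muln 1%N [seq #|'I_(N i)| | i : 'I_n] = (\prod_i N i)%N.
  by rewrite foldrE big_map big_enum/=; apply: eq_bigr => i _; rewrite card_ord.
rewrite -mulr_natl natr_prod -[X in _ * s ^+ X]card_ord -prodr_const -big_split/=.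
apply: ler_prod => i _; rewrite mulr_ge0 ?(ltW s0)//=.
rewrite /N -addn1 natrD mulrDl mul1r lerD2r -ler_pdivlMr//.
by rewrite truncn_le// divr_ge0 ?(ltW s0)// subr_ge0.
Qed.

(** The volume is an outer measure defined by countable covers by boxes, and each
    box of a cover is enlarged at a summable cost. *)
Lemma nu_le_volume (A : set 'cV[R]_n) (B : set (borel_torus L)) :
  measurable B -> B `<=` hits L A -> (nu B <= volume A)%E.
Proof.
move=> mB BA; apply/ereal_infP => _ [a [b [ab Acov ->]]].
apply/lee_addgt0Pr => e e0.
have [T T0 sT] := exists_small dh.
have ek k : exists E : set (borel_torus L), [/\ measurable E,
    hits L (box (a k) (b k)) `<=` E &
    (nu E <= (\prod_i (b k i 0 - a k i 0))%:E + (e / (2 ^ k.+1)%:R)%:E)%E].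
  have e1 : 0 < e / (2 ^ k.+1)%:R by rewrite divr_gt0// ltr0n expn_gt0.
  have [D D0 HD] := @prod_add_small R _ (index_enum 'I_n) (fun i => b k i 0 - a k i 0)
    (fun i => ltac:(by rewrite subr_ge0)).
  pose d := e / (2 ^ k.+1)%:R.
  pose s := Num.min (T / 2) (Num.min 1 (d / (D + 1))).
  have s0 : 0 < s by rewrite !lt_min ltr01 !divr_gt0//; lra.
  have ss : small h (2 * s).
    apply: small_le sT; have : s <= T / 2 by rewrite ge_min lexx.
    by lra.
  have [E [mE sE nE]] := hits_box_le s0 ss (ab k).
  exists E; split => //; apply: (le_trans nE); rewrite lee_fin.
  apply: (le_trans (HD _ (ltW s0) _)); first by rewrite !ge_min lexx orbT.
  rewrite lerD2l -/d; have : s <= d / (D + 1) by rewrite !ge_min lexx !orbT.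
  rewrite ler_pdivlMr; last by lra.
  by rewrite mulrDr mulr1; lra.
have /boolp.choice[E EP] := ek.
apply: (@le_trans _ _ (\sum_(0 <= k <oo) nu (E k))%E).
  apply: measure_sigma_subadditive => //; first by move=> k; have [] := EP k.
  move=> t /BA[x /Acov[k _ xk] <-]; exists k => //.
  by have [_ + _] := EP k; apply; exists x.
apply: (@le_trans _ _ (\sum_(0 <= k <oo)
    ((\prod_i (b k i 0 - a k i 0))%:E + (e / (2 ^ k.+1)%:R)%:E))%E).
  by apply: lee_nneseries => // k _; have [_ _ +] := EP k.
apply: epsilon_trick; last exact: ltW.
by move=> k; rewrite lee_fin; exact: box_volume_ge0.
Qed.

End CoveringBound.

(** * Measurability and the first bound *)

Lemma continuous_sum (R : realType) (S : topologicalType) (I : Type) (r : seq I)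
    (f : I -> S -> R) :
  (forall i, continuous (f i)) -> continuous (fun s => \sum_(i <- r) f i s).
Proof.
move=> cf; elim: r => [|i r IH] s.
  under eq_fun do rewrite big_nil; exact: cst_continuous.
under eq_fun do rewrite big_cons.
by apply: continuousD; [exact: cf|exact: IH].
Qed.

Lemma continuous_enorm (R : realType) n : continuous (@enorm R n).
Proof.
move=> x; apply: continuous_comp; last exact: sqrt_continuous.
apply: continuous_sum => i {}x; under eq_fun do rewrite expr2.
by apply: continuousM; exact: coord_continuous.
Qed.

Section Measurability.
Variables (R : realType) (n : nat).

Lemma lattice_basis (L : lattice R n) :
  exists2 h : 'M[R]_n, \det h = 1 & lattice_points L = lattice_of h.
Proof. by have [h] := lattice_unimodular L; exists h. Qed.

(** The topology of the affine lattices over [L] is the quotient topology of the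
    torus of [L]. *)
Lemma measurable_slice (L : lattice R n) :
  measurable_fun [set: borel_torus L] (fun t => existT _ L t : Xaff R n).
Proof.
have [g <-] := lattice_proj_surj L.
apply: (@measurability _ _ (borel_torus (lattice_proj g)) (Xaff R n) setT _ (quotient_opens (@affine_proj R n))) => // _ [U oU <-].
rewrite setTI; apply: sub_sigma_algebra; rewrite /quotient_opens/=.
rewrite (_ : _ @^-1` _ = (fun x => (g, x)) @^-1` (@affine_proj R n @^-1` U))//.
apply: open_comp => // x _.
have := @cvg_pair _ _ _ (nbhs x) (nbhs g) (nbhs x) _ _ _ (fun=> g) id.
by apply; [exact: cst_continuous|exact: (@cvg_id _ (nbhs x))].
Qed.

Lemma affine_points_proj (gx : SL R n * 'cV[R]_n) z :
  affine_points (affine_proj gx) z <->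
  exists k, z = gx.2 + \val gx.1 *m map_mx intr k.
Proof. by rewrite /affine_points /=; exact: (@torus_points_proj R n (lattice_proj gx.1) (\val gx.1) erefl). Qed.

Lemma rho_aff_lt (S : affine_lattice R n) c :
  rho_aff S < c <-> exists2 z, affine_points S z & enorm z < c.
Proof.
have [z Sz [-> zmin]] := rho_aff_min S; split=> [zc|[w Sw wc]]; first by exists z.
exact: le_lt_trans (zmin _ Sw) wc.
Qed.

Lemma rho_aff_le (S : affine_lattice R n) c :
  rho_aff S <= c <-> exists2 z, affine_points S z & enorm z <= c.
Proof.
have [z Sz [-> zmin]] := rho_aff_min S; split=> [zc|[w Sw wc]]; first by exists z.
exact: le_trans (zmin _ Sw) wc.
Qed.

(** The set where [rho_aff < c] is open: it says that some point, which depends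
    continuously on the basis and the translation, has norm less than [c]. *)
Lemma measurable_rho_aff : measurable_fun [set: Xaff R n] (@rho_aff R n : Xaff R n -> R).
Proof.
apply: (measurability _ (RGenInftyO.measurableE R)).
move=> _ [_ [c ->] <-]; rewrite setTI; apply: sub_sigma_algebra.
rewrite /quotient_opens/=.
have -> : @affine_proj R n @^-1` (@rho_aff R n @^-1` `]-oo, c[) =
   \bigcup_(k in [set: 'cV[int]_n])
   ((fun gx : SL R n * 'cV[R]_n => enorm (gx.2 + \val gx.1 *m map_mx intr k)) @^-1`
     `]-oo, c[).
  apply/seteqP; split=> gx /=.
    rewrite in_itv/= => /rho_aff_lt[_ /affine_points_proj[k ->] kc].
    by exists k; rewrite // /= in_itv.
  move=> [k _ /=]; rewrite !in_itv/= => kc; apply/rho_aff_lt.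
  by exists (gx.2 + \val gx.1 *m map_mx intr k) => //; apply/affine_points_proj; exists k.
apply: bigcup_open => k _; apply: open_comp; last exact: interval_open.
move=> gx _; apply: continuous_comp; last exact: continuous_enorm.
apply: continuous_mx => i j {}gx.
under eq_fun do rewrite !mxE.
apply: continuousD.
  apply: (@continuous_comp _ _ _ snd (fun x : 'cV[R]_n => x i j)).
    exact: cvg_snd.
  exact: coord_continuous.
apply: continuous_sum => l {}gx.
apply: continuousM; last exact: cst_continuous.
apply: (@continuous_comp _ _ _ fst (fun g : SL R n => (\val g) i l)).
  exact: cvg_fst.
apply: (@continuous_comp _ _ _ (fun g : SL R n => \val g) (fun g : 'M[R]_n => g i l)).
  exact: initial_continuous.
exact: coord_continuous.
Qed.

Lemma measurable_rho_itv (i : interval R) :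
  measurable ([set S | rho_aff S \in i] : set (Xaff R n)).
Proof.
by have := measurable_rho_aff measurableT (measurable_itv i); rewrite setTI.
Qed.

Lemma measurable_U_aff : measurable_fun [set: Xaff R n] (@U_aff R n : Xaff R n -> R).
Proof.
apply: measurable_funM; first exact: measurable_cst.
by apply: measurable_funX; exact: measurable_rho_aff.
Qed.

Lemma measurable_U_itv (i : interval R) :
  measurable ([set S | U_aff S \in i] : set (Xaff R n)).
Proof.
by have := measurable_U_aff measurableT (measurable_itv i); rewrite setTI.
Qed.

End Measurability.

Section SmallBalls.
Variables (R : realType) (n : nat).
Hypothesis n0 : (0 < n)%N.
Variables (L : lattice R n) (nu : probability (borel_torus L) R).
Hypothesis nuH : torus_haar nu.

Lemma measurable_slice_set (A : set (Xaff R n)) : measurable A ->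
  measurable [set t : borel_torus L | A (existT _ L t)].
Proof. by move=> mA; have := @measurable_slice R n L measurableT _ mA; rewrite setTI. Qed.

Lemma nu_rho_le (r : R) : 0 < r ->
  (nu [set t | (rho_aff (existT _ L t) <= r)%R] <= (kappa R n * r ^+ n)%:E)%E.
Proof.
move=> r0; have [h dh Lh] := lattice_basis L.
apply: le_trans (volume_ball_le n0 r0).
apply: (nu_le_volume Lh dh nuH) => [|t /= /rho_aff_le[z Sz zr]].
  have := @measurable_slice_set _ (@measurable_rho_itv R n `]-oo, r]).
  by congr (measurable _); apply/seteqP; split=> t /=; rewrite in_itv.
by apply/(hitsP Lh); exists z.
Qed.

(** Every coset of [L] has a point in a large ball, so that [nu_rho_le] for this
    radius bounds 1. *)
Lemma kappa_gt0 : 0 < kappa R n.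
Proof.
have [h dh Lh] := lattice_basis L.
have hu : h \in unitmx by rewrite unitmxE dh unitr1.
pose C := entry_norm h + 1; have C0 : 0 < C.
  by rewrite /C ltr_wpDl// entry_norm_ge0.
pose r := n%:R * C; have r0 : 0 < r by rewrite mulr_gt0 ?ltr0n.
have := nu_rho_le r0; rewrite (_ : [set _ | _] = setT); last first.
  apply/seteqP; split=> // t _; have [x ->] := torus_projP t.
  apply/rho_aff_le; pose k := floor_vec 1 (invmx h *m x).
  exists (h *m (invmx h *m x - map_mx intr k)).
    rewrite mulmxBr mulKVmx//; apply/(torus_points_proj Lh); exists (- k).
    by rewrite map_mxN mulmxN.
  have zb i : `|(h *m (invmx h *m x - map_mx intr k)) i 0| <= C.
    apply: (@le_trans _ _ (entry_norm h * 1)); last by rewrite mulr1 lerDl.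
    apply: mulmx_bound => // j.
    have /in_cubeP/(_ j) := in_cube_floor (invmx h *m x) (ltr01 : 0 < 1 :> R).
    rewrite scale1r -/k; move: (invmx h *m x) (map_mx intr k) => u w.
    by rewrite !mxE ler_norml => ?; apply/andP; split; lra.
  rewrite -[leRHS]ger0_norm ?(ltW r0)// -sqrtr_sqr ler_wsqrtr//.
  apply: (@le_trans _ _ (\sum_(i < n) C ^+ 2)).
    by apply: ler_sum => i _; rewrite -(real_normK (num_real _)) lerXn2r ?nnegrE ?(ltW C0)//; exact: zb.
  rewrite sumr_const card_ord -mulr_natl /r exprMn ler_wpM2r ?sqr_ge0//.
  by rewrite expr2 ler_peMr// ler1n.
rewrite probability_setT lee_fin => h1.
by rewrite -(pmulr_lgt0 _ (exprn_gt0 n r0)) (lt_le_trans ltr01).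
Qed.

End SmallBalls.

(** Integrate [nu_rho_le] over the space of lattices. *)
Lemma prob_U_le (R : realType) (n : nat) (P : probability (Xaff R n) R) (u : R) :
  (0 < n)%N -> affine_haar P -> 0 < u ->
  (P [set S | (U_aff S <= u)%R] <= u%:E)%E.
Proof.
move=> n0 [mu [nu [_ nuH Pint]]] u0.
have mA : measurable ([set S | (U_aff S <= u)%R] : set (Xaff R n)).
  have := @measurable_U_itv R n `]-oo, u].
  by congr (measurable _); apply/seteqP; split=> t /=; rewrite in_itv.
have [mc ->] := Pint _ mA.
rewrite -[leRHS]mule1 -(@probability_setT _ _ _ mu) -integral_cst//.
apply: ge0_le_integral => //.
  move=> L _; have k0 := kappa_gt0 n0 (nuH L).
  pose r := (u / kappa R n) `^ (n%:R^-1).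
  have r0 : 0 < r by rewrite powR_gt0// divr_gt0.
  have rE : kappa R n * r ^+ n = u.
    rewrite /r -powR_mulrn ?powR_ge0// -powRrM mulVf ?pnatr_eq0 -?lt0n//.
    by rewrite powRr1 ?divr_ge0 ?(ltW u0) ?(ltW k0)// mulrC divfK ?gt_eqF.
  rewrite /cst -[in leRHS]rE; apply: le_trans (nu_rho_le n0 (nuH L) r0).
  apply: le_measure; [apply: mem_set|apply: mem_set|].
  - exact: (@measurable_slice_set R n L _ mA).
  - have := @measurable_slice_set R n L _ (@measurable_rho_itv R n `]-oo, r]).
    by congr (measurable _); apply/seteqP; split=> t /=; rewrite in_itv.
  move=> t /=; rewrite -rE /U_aff ler_pM2l// => H.
  rewrite leNgt; apply/negP => rr; move: H; apply/negP; rewrite -ltNge.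
  by rewrite ltrXn2r ?(ltW r0)// -lt0n.
Qed.

(** * Second moment of the number of points *)

Lemma int_cube_disjoint (R : realType) n (s : R) (w w' : 'cV[int]_n) z : 0 < s ->
  cube (s *: map_mx intr w) s z -> cube (s *: map_mx intr w') s z -> w = w'.
Proof.
move=> s0 /in_cubeP zw /in_cubeP zw'; apply/matrixP => i j; rewrite [j]ord1.
have := zw i; have := zw' i; rewrite !mxE => /andP[a b] /andP[c d].
apply/eqP; rewrite eq_le; apply/andP; split; rewrite -ltzD1 -(ltr_int R) intrD
  -(ltr_pM2l s0) mulrDr mulr1; lra.
Qed.

Section SecondMoment.
Variables (R : realType) (n : nat) (L : lattice R n) (h : 'M[R]_n).
Hypothesis Lh : lattice_points L = lattice_of h.
Hypothesis dh : \det h = 1.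
Variable nu : probability (borel_torus L) R.
Hypothesis nuH : torus_haar nu.
Variables (Delta : R) (W : seq 'cV[int]_n) (K : nat).
Hypothesis Delta0 : 0 < Delta.
Hypothesis uW : uniq W.
Hypothesis W0 : (0 < size W)%N.
Hypothesis K0 : (0 < K)%N.

Let delta := Delta / K%:R.
Hypothesis sdelta : small h (2 * delta).

Let delta0 : 0 < delta. Proof. by rewrite divr_gt0// ltr0n. Qed.

Let deltaK : delta * K%:R = Delta.
Proof. by rewrite divfK// pnatr_eq0 -lt0n. Qed.

Let corner (p : 'cV[int]_n * {ffun 'I_n -> 'I_K}) : 'cV[R]_n :=
  grid_pt (Delta *: map_mx intr p.1) delta p.2.

Let cell p := cube (corner p) delta.

Let cell_sub p : cell p `<=` cube (Delta *: map_mx intr p.1) Delta.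
Proof. by rewrite -[X in _ `<=` cube _ X]deltaK; exact: grid_cell_sub. Qed.

Let cell_disjoint p q z : cell p z -> cell q z -> p = q.
Proof.
case: p q => [w e] [w' e'] pz qz.
have ww' : w = w' := int_cube_disjoint Delta0 (cell_sub pz) (cell_sub qz).
by rewrite -ww' in qz *; congr pair; exact: grid_cell_disjoint pz qz.
Qed.

Let cells := allpairs pair W (index_enum {ffun 'I_n -> 'I_K}).

Let cells_uniq : uniq cells.
Proof.
apply: allpairs_uniq => //; first exact: index_enum_uniq.
by move=> [? ?] [? ?] _ _ /= [-> ->].
Qed.

Let cellsW p : p \in cells -> p.1 \in W.
Proof. by move=> /allpairsP[[w e] [/= wW _ ->]]. Qed.

Let Vol := (size W)%:R * Delta ^+ n.

Let Vol0 : 0 < Vol.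
Proof. by rewrite mulr_gt0 ?ltr0n// exprn_gt0. Qed.

Variable bx : seq 'cV[int]_n.
Hypothesis bxP : forall k z, k != 0 ->
  (exists2 w, w \in W & cube (Delta *: map_mx intr w) Delta z) ->
  (exists2 w, w \in W &
     cube (Delta *: map_mx intr w) Delta (z + h *m map_mx intr k)) -> k \in bx.

Let D p : R := \sum_(w' <- W) \sum_(k <- bx)
  (in_cube (Delta *: map_mx intr w' - corner p - const_mx delta) (Delta + delta)
     (h *m map_mx intr k))%:R.

Let D_ge0 p : 0 <= D p.
Proof. by apply: sumr_ge0 => w _; apply: sumr_ge0 => k _; rewrite ler0n. Qed.

Let X p t : R := \1_(hits L (cell p)) t.

Let N_le p t : p \in cells -> X p t = 1 -> \sum_(q <- cells) X q t <= 1 + D p.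
Proof.
move=> pc; have [x ->] := torus_projP t; rewrite /X indicE => Xp.
have /set_mem/(hits_proj Lh)[k0 k0p] : torus_proj L x \in hits L (cell p).
  by apply/negPn/negP => /negbTE H; move: Xp; rewrite H => /esym/eqP; rewrite oner_eq0.
have [s [us -> sP]] := @count_cells R n L h Lh _ cells cell x cells_uniq cell_disjoint.
pose good k := has (fun w' =>
   in_cube (Delta *: map_mx intr w' - corner p - const_mx delta) (Delta + delta)
     (h *m map_mx intr k)) W.
have sz1 : (size s <= (size (rem k0 s)).+1)%N.
  have [k0s|k0s] := boolP (k0 \in s); last by rewrite rem_id.
  by rewrite size_rem// prednK// -has_predT; apply/hasP; exists k0.
have sz2 : (size (rem k0 s) <= count good bx)%N.
  rewrite -size_filter -(size_map (fun k => k - k0)); apply: uniq_leq_size.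
    by rewrite map_inj_uniq ?rem_uniq//; exact: addIr.
  move=> y /mapP[k + ->] {y}; rewrite mem_rem_uniq// inE => /andP[kk0 ks].
  have [q qc kq] := sP _ ks.
  have hE : h *m map_mx intr (k - k0) =
      (x + h *m map_mx intr k) - (x + h *m map_mx intr k0).
    by rewrite map_mxB mulmxBr opprD addrACA subrr add0r.
  rewrite mem_filter; apply/andP; split.
    apply/hasP; exists q.1; first exact: cellsW.
    rewrite hE; move/in_cubeP : (cell_sub kq); move/in_cubeP : k0p.
    move: (_ + _) (_ + _) (corner p) (map_mx intr q.1) => u v c w cu wv.
    apply/in_cubeP => i; have := cu i; have := wv i; rewrite !mxE; lra.
  apply: (@bxP _ (x + h *m map_mx intr k0)); first by rewrite subr_eq0.
    by exists p.1; [exact: cellsW|exact: cell_sub].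
  exists q.1; first exact: cellsW.
  by rewrite hE addrC subrK; exact: cell_sub.
apply: (@le_trans _ _ (1 + (count good bx)%:R)).
  by rewrite -[1]/(1%:R) -natrD ler_nat add1n; exact: leq_trans sz1 _.
rewrite lerD2l /D exchange_big/= -sum1_count natr_sum big_mkcond.
apply: ler_sum => k _; case: ifPn => [/hasP[w wW wk]|_]; last exact: sumr_ge0.
rewrite (bigD1_seq w)//= wk lerDl; exact: sumr_ge0.
Qed.

(** Chebyshev's inequality for the number [N] of cells of a fine grid, inside the
    union of the cubes, that the coset meets. In [N^2] the pairs of equal cells give
    the term [Vol^-1]. For distinct cells the difference of two points of the coset
    is a nonzero vector of [L]; given the first cell, whose corner is a [grid_pt],
    and the cube of the second point, it lies in a cube of side [Delta + delta],
    which is slightly larger than the cube itself because the position in the first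
    cell is not known. *)
Lemma nu_miss_le (B : set (borel_torus L)) : measurable B ->
    (forall t z w, B t -> w \in W -> torus_points t z ->
       ~ cube (Delta *: map_mx intr w) Delta z) ->
  fine (nu B) <= Vol^-1 - 1 + Vol^-2 * (\sum_(w <- W)
    \sum_(e : {ffun 'I_n -> 'I_K}) delta ^+ n * \sum_(w' <- W) \sum_(k <- bx)
      (in_cube (Delta *: map_mx intr w' - grid_pt (Delta *: map_mx intr w) delta e
                - const_mx delta) (Delta + delta) (h *m map_mx intr k))%:R).
Proof.
move=> mB Bmiss.
pose a p := - (2 / Vol) + (1 + D p) / Vol ^+ 2.
have mcell p : measurable (hits L (cell p)) by exact: (measurable_cube Lh).
have ptw t : \1_B t <= 1 + \sum_(p <- cells) a p * X p t.
  have [tB|tB] := boolP (t \in B).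
    rewrite indicE tB big1_seq ?addr0// => p /= pc.
    rewrite /X indicE memNset ?mulr0// => /(hitsP Lh)[z pz tz].
    exact: (Bmiss t z p.1 (set_mem tB) (cellsW pc) tz (cell_sub pz)).
  rewrite indicE (negbTE tB).
  pose N := \sum_(p <- cells) X p t.
  (* [(1 - N / Vol) ^ 2 >= 0], made linear in the indicators by a bound for [N ^ 2] *)
  have N2 : N ^+ 2 <= \sum_(p <- cells) (1 + D p) * X p t.
    rewrite expr2 {1}/N mulr_suml big_seq [leRHS]big_seq; apply: ler_sum => p pc.
    have : X p t = 0 \/ X p t = 1 by rewrite /X indicE; case: (_ \in _); [right|left].
    case=> Xp; rewrite Xp ?mulr0 ?mul0r// mul1r mulr1.
    exact: N_le.
  have -> : \sum_(p <- cells) a p * X p t =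
      - (2 / Vol) * N + (\sum_(p <- cells) (1 + D p) * X p t) / Vol ^+ 2.
    rewrite mulr_sumr mulr_suml -big_split; apply: eq_bigr => p _ /=.
    by rewrite /a mulrDl; congr (_ + _); rewrite mulrAC.
  apply: (@le_trans _ _ ((1 - N / Vol) ^+ 2)); first exact: sqr_ge0.
  have -> : (1 - N / Vol) ^+ 2 = 1 + (- (2 / Vol) * N + N ^+ 2 / Vol ^+ 2).
    by field; rewrite gt_eqF.
  by rewrite !lerD2l ler_wpM2r// invr_ge0 exprn_ge0// ltW.
have := prob_lin nu mB mcell ptw.
have -> : \sum_(p <- cells) a p * fine (nu (hits L (cell p))) =
    \sum_(p <- cells) a p * delta ^+ n.
  by apply: eq_bigr => p _; rewrite (nu_cube Lh).
have VE : \sum_(p <- cells) delta ^+ n = Vol.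
  rewrite /cells big_allpairs/=.
  rewrite (eq_bigr (fun=> Delta ^+ n)); last first.
    by move=> w _; rewrite sum_grid_const -exprMn mulrC deltaK.
  by rewrite big_const_seq count_predT iter_addr addr0 -mulr_natl.
move=> le1; apply: (le_trans le1).
have -> : \sum_(p <- cells) a p * delta ^+ n =
    (- (2 / Vol) + Vol ^- 2) * \sum_(p <- cells) delta ^+ n +
    Vol ^- 2 * \sum_(p <- cells) delta ^+ n * D p.
  rewrite !mulr_sumr -big_split; apply: eq_bigr => p _ /=.
  by rewrite /a; move: (delta ^+ n) => q; field; rewrite gt_eqF.
rewrite VE addrA /cells big_allpairs/=.
rewrite lerD2r mulrDl mulNr divfK ?gt_eqF//.
have -> : Vol ^- 2 * Vol = Vol^-1 by field; rewrite gt_eqF.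
lra.
Qed.

End SecondMoment.

(** * Averages over shears *)

Section Shears.
Variables (R : realType) (m : nat).

(** The expansion [diag(q^-m, q, ..., q)] after the shear [v' + v_0 x / M]. *)
Definition shear (q M : nat) (x : {ffun 'I_m -> 'I_M}) : 'M[R]_(1 + m) :=
  block_mx (q%:R ^- m)%:M 0 (q%:R *: \col_i ((x i)%:R / M%:R)) q%:R%:M.

Lemma det_shear q M (x : {ffun 'I_m -> 'I_M}) : (0 < q)%N -> \det (shear q x) = 1.
Proof.
move=> q0; rewrite det_lblock det_scalar1 det_scalar mulVf//.
by rewrite expf_neq0// pnatr_eq0 -lt0n.
Qed.

Lemma in_cube_shear q M (x : {ffun 'I_m -> 'I_M}) (y v : 'cV[R]_(1 + m)) T :
  in_cube y T (shear q x *m v) =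
    (usubmx y 0 0 <= q%:R ^- m * usubmx v 0 0 < usubmx y 0 0 + T) &&
    [forall i, dsubmx y i 0 <=
       q%:R * ((x i)%:R / M%:R * usubmx v 0 0 + dsubmx v i 0) < dsubmx y i 0 + T].
Proof.
rewrite -[v in LHS]vsubmxK mul_block_col in_cube_col mul0mx addr0.
have E0 i : ((q%:R ^- m)%:M *m usubmx v) i 0 = q%:R ^- m * usubmx v 0 0 :> R.
  by rewrite ord1 mul_scalar_mx mxE.
have E i : (q%:R *: \col_i ((x i)%:R / M%:R) *m usubmx v + q%:R%:M *m dsubmx v) i 0 =
    q%:R * ((x i)%:R / M%:R * usubmx v 0 0 + dsubmx v i 0) :> R.
  rewrite mul_scalar_mx; move: (usubmx v) (dsubmx v) => a b.
  by rewrite !mxE big_ord1 !mxE; ring.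
congr andb.
  by apply/in_cubeP/idP => [/(_ 0)|H i]; rewrite E0// ord1.
by apply/in_cubeP/forallP => H i; have := H i; rewrite E.
Qed.

(** A probability over the shears, written as a finite average so that nothing has
    to be measurable in the shear. *)
Definition weight (q M : nat) (y : 'cV[R]_(1 + m)) (T : R) (v : 'cV[R]_(1 + m)) : R :=
  (M%:R ^+ m)^-1 *
    \sum_(x : {ffun 'I_m -> 'I_M}) (in_cube y T (shear q x *m v))%:R.

Lemma weight_le1 q M y T v : (0 < M)%N -> weight q M y T v <= 1.
Proof.
move=> M0; have M0' : 0 < M%:R ^+ m :> R by rewrite exprn_gt0// ltr0n.
rewrite /weight mulrC ler_pdivrMr// mul1r -[leRHS]mulr1 -sum_grid_const.
by apply: ler_sum => x _; rewrite lern1 leq_b1.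
Qed.

Lemma weight_neq0 q M y T v : weight q M y T v != 0 ->
  exists x : {ffun 'I_m -> 'I_M}, in_cube y T (shear q x *m v).
Proof.
move=> w0; apply/existsP; apply: contraNT w0; rewrite negb_exists => /forallP H.
by rewrite /weight big1 ?mulr0// => x _; rewrite (negbTE (H x)).
Qed.

(** The coordinates of the shear are independent. For each of them the grid points
    that work lie in an interval of length [T M / (q |v_0|)]. *)
Lemma weight_le q M y T v : (0 < q)%N -> (0 < M)%N -> 0 <= T -> usubmx v 0 0 != 0 ->
  weight q M y T v <= (T / (q%:R * `|usubmx v 0 0|) + M%:R^-1) ^+ m.
Proof.
move=> q0 M0 T0 v0.
have M0' : 0 < M%:R :> R by rewrite ltr0n.
have q0' : 0 < q%:R :> R by rewrite ltr0n.
pose F i (j : 'I_M) : R := (dsubmx y i 0 <=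
       q%:R * (j%:R / M%:R * usubmx v 0 0 + dsubmx v i 0) < dsubmx y i 0 + T)%R%:R.
rewrite /weight mulrC ler_pdivrMr ?exprn_gt0//.
apply: (@le_trans _ _ (\sum_(x : {ffun 'I_m -> 'I_M}) \prod_i F i (x i))).
  apply: ler_sum => x _; rewrite in_cube_shear; case: andP => [[_ /forallP H]|_].
    by rewrite big1// => i _; rewrite /F H.
  by apply: prodr_ge0 => i _; rewrite ler0n.
rewrite -bigA_distr_bigA -exprMn -[X in _ ^+ X]card_ord -prodr_const.
apply: ler_prod => i _; apply/andP; split.
  by apply: sumr_ge0 => j _; rewrite ler0n.
pose s := [seq (nat_of_ord j)%:Z | j <- index_enum 'I_M & F i j != 0].
have -> : \sum_j F i j = (size s)%:R.
  rewrite /s size_map size_filter -sum1_count natr_sum [RHS]big_mkcond/=.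
  by apply: eq_bigr => j _; rewrite /F; case: (_ <= _ < _); rewrite ?oner_neq0 ?eqxx.
have -> : (T / (q%:R * `|usubmx v 0 0|) + M%:R^-1) * M%:R =
    T / `|q%:R * (usubmx v 0 0 / M%:R)| + 1.
  rewrite normrM normrM normfV [`|q%:R|]gtr0_norm// [`|M%:R|]gtr0_norm//.
  by field; rewrite normr_eq0 v0 !gt_eqF.
apply: (@size_int_affine _ _ _ (dsubmx y i 0 - q%:R * dsubmx v i 0)) => //.
- rewrite map_inj_uniq ?filter_uniq ?index_enum_uniq//.
  by move=> j j' /= [] /val_inj.
- by apply: mulf_neq0; [rewrite gt_eqF|apply: mulf_neq0; rewrite ?invr_eq0 ?(gt_eqF M0')].
- move=> _ /mapP[j + ->]; rewrite mem_filter => /andP[+ _].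
  rewrite /F; case: (boolP (_ <= _ < _)) => [+ _|]; last by rewrite eqxx.
  have -> : q%:R * (usubmx v 0 0 / M%:R) * (nat_of_ord j)%:~R =
     q%:R * (j%:R / M%:R * usubmx v 0 0 + dsubmx v i 0) - q%:R * dsubmx v i 0.
    by rewrite -pmulrn; field; rewrite gt_eqF.
  by move: (q%:R * dsubmx v i 0) (q%:R * (_ + _)) => a b; lra.
Qed.

Lemma weight_support q M (y v : 'cV[R]_(1 + m)) T C : (0 < q)%N -> 0 <= T ->
    (forall i, `|y i 0| + T <= C) -> weight q M y T v != 0 ->
  [/\ usubmx y 0 0 <= q%:R ^- m * usubmx v 0 0 < usubmx y 0 0 + T,
      `|usubmx v 0 0| <= q%:R ^+ m * C &
      forall i, exists2 x, 0 <= x <= 1 & q%:R * `|x * usubmx v 0 0 + dsubmx v i 0| <= C].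
Proof.
move=> q0 T0 yC /weight_neq0[x]; rewrite in_cube_shear => /andP[H /forallP Hi].
have q0' : 0 < q%:R :> R by rewrite ltr0n.
have norm_itv (a z : R) : `|a| + T <= C -> a <= z < a + T -> `|z| <= C.
  have /andP[a1 a2] : - `|a| <= a <= `|a| by rewrite -ler_norml.
  by move=> aC /andP[z1 z2]; rewrite ler_norml; apply/andP; split; lra.
split => //.
  have qm0 : 0 < q%:R ^+ m :> R by rewrite exprn_gt0.
  rewrite mulrC -ler_pdivrMr// -[X in _ / X]gtr0_norm// -normfV -normrM mulrC.
  by apply: norm_itv H; rewrite !mxE.
move=> i; exists ((x i)%:R / M%:R).
  have M0 : (0 < M)%N by case: (M) (x i) => // -[].
  have M0' : 0 < M%:R :> R by rewrite ltr0n.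
  by rewrite divr_ge0 ?ler0n//= ler_pdivrMr// mul1r ler_nat ltnW.
rewrite -[X in X * _]gtr0_norm// -normrM.
by apply: norm_itv (Hi i); rewrite !mxE.
Qed.

(** If [v_0 <> 0], this is [weight_le]; if [v_0 = 0], a large [q] expels [v]. *)
Lemma weight_decay (v : 'cV[R]_(1 + m)) (T C : R) : (0 < m)%N -> v != 0 -> 0 <= T ->
  exists2 A : R, 0 <= A & forall q M (y : 'cV[R]_(1 + m)), (0 < q)%N -> (q <= M)%N ->
    (forall i, `|y i 0| + T <= C) -> weight q M y T v <= A / q%:R.
Proof.
move=> m0 v0 T0; have [u0|u0] := eqVneq (usubmx v 0 0) 0.
  have [i vi] : exists i, dsubmx v i 0 != 0.
    apply/existsP; apply: contraNT v0; rewrite negb_exists => /forallP H.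
    rewrite -[v]vsubmxK; apply/eqP/matrixP => i j; rewrite [j]ord1.
    case: (split_ordP i) => k ->; rewrite ?col_mxEu ?col_mxEd [RHS]mxE ?ord1//.
    by have := H k; rewrite negbK => /eqP.
  exists (`|C| / `|dsubmx v i 0|); first by rewrite divr_ge0.
  move=> q M y q0 qM yC.
  have [->|w0] := eqVneq (weight q M y T v) 0; first by rewrite !divr_ge0.
  have [_ _ /(_ i)[x _]] := weight_support q0 T0 yC w0.
  rewrite u0 mulr0 add0r => qC; apply: (@le_trans _ _ 1).
    by apply: weight_le1; exact: leq_trans q0 qM.
  rewrite ler_pdivlMr ?ltr0n// mul1r ler_pdivlMr ?normr_gt0//.
  exact: (le_trans qC (ler_norm _)).
pose A := T / `|usubmx v 0 0| + 1.
have A0 : 0 <= A by rewrite addr_ge0// divr_ge0.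
exists (A ^+ m); first by rewrite exprn_ge0.
move=> q M y q0 qM yC; have M0 := leq_trans q0 qM.
have q0' : 0 < q%:R :> R by rewrite ltr0n.
apply: (le_trans (weight_le y q0 M0 T0 u0)).
apply: (@le_trans _ _ ((A / q%:R) ^+ m)).
  rewrite lerXn2r ?nnegrE ?divr_ge0// ?addr_ge0 ?invr_ge0 ?divr_ge0 ?mulr_ge0//.
  have -> : A / q%:R = T / (q%:R * `|usubmx v 0 0|) + q%:R^-1.
    by rewrite /A; field; rewrite normr_eq0 u0 gt_eqF.
  by rewrite lerD2l lef_pV2 ?posrE ?ltr0n// ler_nat.
rewrite exprMn ler_wpM2l ?exprn_ge0// exprVn lef_pV2 ?posrE ?exprn_gt0//.
by rewrite -[leLHS]expr1 ler_weXn2l ?ler1n.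
Qed.

(** An anisotropic version of [sparse_det], obtained from a tiling by cubes. *)
Lemma size_lattice_box (h : 'M[R]_(1 + m)) (theta : R) : \det h = 1 -> 1 < theta ->
  exists2 S : R, 0 < S & forall (a0 : R) (a : 'cV[R]_m) (l0 l : R) (s : seq 'cV[int]_(1 + m)),
    0 <= l0 -> 0 <= l -> uniq s ->
    (forall k, k \in s -> a0 <= usubmx (h *m map_mx intr k) 0 0 < a0 + l0) ->
    (forall k, k \in s -> in_cube a l (dsubmx (h *m map_mx intr k))) ->
  (size s)%:R <= theta * ((l0 + S) * (l + S) ^+ m).
Proof.
move=> dh /(@root_gt1 _ _ (2 * (1 + m)))[t t1 tt].
have dh0 : \det h != 0 by rewrite dh oner_eq0.
have [c c0 hc] := sparse_det dh0 t1; move: hc; rewrite dh normr1 invr1 => hc.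
(* chosen so that [t * S + c] is at most [t ^+ 2 * S] *)
pose S := (c + 1) / (t * (t - 1)).
have tt0 : 0 < t * (t - 1) by nra.
have S0 : 0 < S by rewrite divr_gt0//; lra.
have Sc : t * S + c <= t ^+ 2 * S.
  have : t * (t - 1) * S = c + 1 by rewrite /S mulrC divfK// gt_eqF.
  by rewrite expr2; nra.
exists S => // a0 a l0 l s l00 l_0 us sa0 sa.
have [l0S lS] : 0 <= l0 / S /\ 0 <= l / S by split; rewrite divr_ge0// ltW.
pose z k : 'cV[R]_(1 + m) := h *m map_mx intr k - col_mx a0%:M a.
pose f k := floor_vec S (z k).
have subE (A B : 'cV[R]_(1 + m)) i : (A - B) i 0 = A i 0 - B i 0 by rewrite !mxE.
have zl k : z k (lshift m 0) 0 = usubmx (h *m map_mx intr k) 0 0 - a0.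
  rewrite /z; move: (h *m _) => u.
  by rewrite subE col_mxEu [a0%:M _ _]mxE eqxx mulr1n [in RHS]mxE.
have zr k i : z k (rshift 1 i) 0 = dsubmx (h *m map_mx intr k) i 0 - a i 0.
  rewrite /z; move: (h *m _) => u.
  by rewrite subE col_mxEd [in RHS]mxE.
have fE k i : (f k i 0)%:~R <= z k i 0 / S < (f k i 0)%:~R + 1.
  by rewrite /f !mxE -intrD1 floor_itv.
apply: (@le_trans _ _ (((l0 / S + 1) * (l / S + 1) ^+ m) * (t ^+ 2 * S) ^+ (1 + m))).
  apply: (@size_fibers _ _ _ _ f).
  - by rewrite exprn_ge0// mulr_ge0 ?sqr_ge0// ltW.
  - have zf j : j \in undup [seq f k | k <- s] -> exists2 k, k \in s & j = f k.
      by rewrite mem_undup => /mapP.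
    have floor_lt (y l' : R) (j : int) : j%:~R <= y / S < j%:~R + 1 ->
        0 <= y < l' -> (0 : R) <= j%:~R < 0 + l' / S.
      move=> /andP[j1 j2] /andP[y0 yl]; rewrite add0r.
      rewrite (le_lt_trans j1) ?ltr_pM2r ?invr_gt0// andbT.
      rewrite -[0]/(0%:~R) ler_int -ltzD1 -(ltr_int R) intrD.
      by apply: le_lt_trans j2; rewrite divr_ge0// ltW.
    apply: (@size_fibers _ _ _ _ usubmx).
    + by rewrite exprn_ge0// addr_ge0.
    + apply: (@size_cV1 _ _ 0) => //; first exact: undup_uniq.
      move=> j; rewrite mem_undup => /mapP[j' /zf[k ks ->] ->].
      rewrite mxE; apply: (floor_lt _ _ _ (fE k _)).
      by have := sa0 _ ks; rewrite zl; lra.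
    + move=> j; rewrite -(size_map dsubmx).
      apply: (@size_int_cube _ _ _ 0) => //.
        by apply: uniq_fiber_usubmx; exact: undup_uniq.
      move=> j' /mapP[j'']; rewrite mem_filter => /andP[_ /zf[k ks ->]] ->.
      apply/in_cubeP => i; rewrite [map_mx _ _ _ _]mxE [dsubmx _ _ _]mxE mxE.
      apply: (floor_lt _ _ _ (fE k _)).
      by have /in_cubeP/(_ i) := sa _ ks; rewrite zr; lra.
  - move=> j; apply: (@le_trans _ _ (1 * (t * S + c) ^+ (1 + m))).
      apply: (hc _ (S *: map_mx intr j + col_mx a0%:M a)); [lra|exact: filter_uniq|].
      move=> k; rewrite mem_filter => /andP[/eqP <- _]; apply/in_cubeP => i.
      have /in_cubeP/(_ i) := in_cube_floor (z k) S0; rewrite -/(f k) /z.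
      move: (map_mx intr (f k)) (h *m _) (col_mx _ _) => u v w.
      by rewrite !mxE; lra.
    rewrite mul1r lerXn2r ?nnegrE; nra.
have -> : (l0 / S + 1) * (l / S + 1) ^+ m * (t ^+ 2 * S) ^+ (1 + m) =
    t ^+ (2 * (1 + m)) * ((l0 + S) * (l + S) ^+ m).
  have -> : l0 / S + 1 = (l0 + S) / S by field; rewrite gt_eqF.
  have -> : l / S + 1 = (l + S) / S by field; rewrite gt_eqF.
  rewrite [(_ / S) ^+ m]exprMn exprMn -exprM exprVn [S ^+ (1 + m)]exprS.
  move: (t ^+ _) ((l + S) ^+ m) => x y; field.
  by rewrite expf_neq0 ?gt_eqF.
rewrite ler_wpM2r// mulr_ge0 ?exprn_ge0// addr_ge0// ltW//.
Qed.

End Shears.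

Lemma sum_subset_le (R : realType) (I : eqType) (s r : seq I) (A : I -> R) :
    uniq s -> uniq r -> {subset s <= r} -> (forall i, 0 <= A i) ->
  \sum_(i <- s) A i <= \sum_(i <- r) A i.
Proof.
move=> us ur sr A0; have -> : \sum_(i <- s) A i = \sum_(i <- r | i \in s) A i.
  rewrite -[RHS]big_filter; apply: perm_big; apply: uniq_perm => //.
    exact: filter_uniq.
  by move=> i; rewrite mem_filter; case: (boolP (i \in s)) => // /sr ->.
by rewrite [leRHS](bigID (mem s))/= lerDl; apply: sumr_ge0.
Qed.

Section MeanValue.
Variables (R : realType) (m : nat) (h : 'M[R]_(1 + m)).
Hypothesis dh : \det h = 1.
Hypothesis m0 : (0 < m)%N.

Local Notation pt k := (h *m map_mx intr k).
Local Notation v0 k := (usubmx (pt k) 0 0).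

Let hu : h \in unitmx. Proof. by rewrite unitmxE dh unitr1. Qed.

(** Only finitely many vectors with bounded [v_0] are ever moved into the cube, and
    [weight_decay] applies to each of them. *)
Lemma near_weight (T C rho : R) : 0 <= T -> exists2 A : R, 0 <= A &
  forall q M (y : 'cV[R]_(1 + m)) (s : seq 'cV[int]_(1 + m)),
    (0 < q)%N -> (q <= M)%N -> (forall i, `|y i 0| + T <= C) -> uniq s -> 0 \notin s ->
    (forall k, k \in s -> `|v0 k| < rho) ->
  \sum_(k <- s) weight q M y T (pt k) <= A / q%:R.
Proof.
move=> T0.
have [F uF FP] := int_box_seq (`|rho| + `|C|) hu.
have /boolp.choice[A AP] (k : 'cV[int]_(1 + m)) : exists A : R, 0 <= A /\ (k != 0 ->
  forall q M (y : 'cV[R]_(1 + m)), (0 < q)%N -> (q <= M)%N ->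
  (forall i, `|y i 0| + T <= C) -> weight q M y T (pt k) <= A / q%:R).
  have [->|k0] := eqVneq k 0; first by exists 0.
  have hk0 : pt k != 0.
    apply: contraNneq k0 => hk; apply/eqP/matrixP => i j; apply: (@intr_inj R).
    have := congr1 (mulmx (invmx h)) hk; rewrite mulKmx// mulmx0.
    by move=> /matrixP/(_ i j); rewrite !mxE.
  by have [A A0 HA] := weight_decay C m0 hk0 T0; exists A; split.
exists (\sum_(k <- F) A k) => [|q M y s q0 qM yC us s0 srho].
  by apply: sumr_ge0 => k _; have [] := AP k.
have q0' : 0 < q%:R :> R by rewrite ltr0n.
have q1 : 1 <= q%:R :> R by rewrite ler1n.
rewrite (bigID (fun k => weight q M y T (pt k) == 0))/= big1 ?add0r; last by move=> k /eqP.
rewrite -big_filter mulr_suml.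
apply: (@le_trans _ _ (\sum_(k <- [seq k <- s | weight q M y T (pt k) != 0]) (A k / q%:R))).
  rewrite big_seq [leRHS]big_seq; apply: ler_sum => k; rewrite mem_filter => /andP[_ ks].
  have [_ HA] := AP k; apply: HA => //.
  by apply: contraNneq s0 => <-.
apply: sum_subset_le => //; first exact: filter_uniq.
  move=> k; rewrite mem_filter => /andP[w0 ks]; apply: FP => i.
  have [_ _ H] := weight_support q0 T0 yC w0.
  have rk : `|v0 k| < `|rho| by apply: lt_le_trans (srho _ ks) (ler_norm _).
  case: (split_ordP i) => j ->.
    rewrite (_ : pt k _ _ = v0 k); last by rewrite [RHS]mxE ord1.
    by rewrite (le_trans (ltW rk))// lerDl.
  rewrite (_ : pt k _ _ = dsubmx (pt k) j 0); last by rewrite [RHS]mxE.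
  have [x /andP[x0 x1]] := H j; move: (dsubmx _ j 0) => d qC.
  have dC : `|x * v0 k + d| <= `|C|.
    apply: le_trans (ler_norm C); apply: le_trans qC.
    by rewrite ler_peMl.
  have -> : d = (x * v0 k + d) - x * v0 k by rewrite addrC addKr.
  apply: (le_trans (ler_normB _ _)); rewrite addrC lerD//.
  rewrite normrM ger0_norm//; apply: le_trans (ltW rk).
  by rewrite ler_piMl.
by move=> k; rewrite divr_ge0 ?ler0n//; have [] := AP k.
Qed.

(** All vectors in the slab have [|v_0|] close to [|j b|], and those that count have
    their other coordinates in an interval of about this length. The powers of
    [|j b|] in the number of vectors and in their weights cancel. The bound [rho]
    is so large that the errors cost at most factors [t]. *)
Lemma slab_weight (T C t S b : R) : 0 < T -> T <= C -> 1 < t -> 0 < S -> b = S / (t - 1) ->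
    (forall (a0 : R) (a : 'cV[R]_m) (l0 l : R) (s : seq 'cV[int]_(1 + m)),
      0 <= l0 -> 0 <= l -> uniq s ->
      (forall k, k \in s -> a0 <= v0 k < a0 + l0) ->
      (forall k, k \in s -> in_cube a l (dsubmx (pt k))) ->
      (size s)%:R <= t * ((l0 + S) * (l + S) ^+ m)) ->
  exists rho : R, forall q (y : 'cV[R]_(1 + m)) (s : seq 'cV[int]_(1 + m)) (j : int),
    (0 < q)%N -> C <= q%:R * (t - 1) * T -> (forall i, `|y i 0| + T <= C) -> uniq s ->
    (forall k, k \in s -> [/\ rho <= `|v0 k|, j%:~R * b <= v0 k < j%:~R * b + b &
        weight q (q ^ m.+2) y T (pt k) != 0]) ->
  \sum_(k <- s) weight q (q ^ m.+2) y T (pt k) <= t ^+ 2 * b * (t ^+ 2 * T / q%:R) ^+ m.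
Proof.
move=> T0 TC t1 S0 bE box; have t10 : 0 < t - 1 by rewrite subr_gt0.
have b0 : 0 < b by rewrite bE divr_gt0.
have bS : b + S = t * b.
  by rewrite bE; field; rewrite gt_eqF.
pose E := b + 2 * C + 1 + S.
have E0 : 0 < E by rewrite /E; lra.
(* with [u = |j b|], [|v_0| >= rho] gives [u + E <= t * (u - b)] *)
exists (b + (E + t * b) / (t - 1)) => q y s j q0 Cq yC us sP.
have q0' : 0 < q%:R :> R by rewrite ltr0n.
have q1 : 1 <= q%:R :> R by rewrite ler1n.
have [->|[k0 k0s]] : s = [::] \/ exists k0, k0 \in s.
    by case: (s) => [|k s']; [left|right; exists k; exact: mem_head].
  rewrite big_nil; apply: mulr_ge0; [apply: mulr_ge0; [exact: sqr_ge0|exact: ltW]|apply: exprn_ge0; apply: divr_ge0 => //; apply: mulr_ge0; [exact: sqr_ge0|exact: ltW]].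
pose u : R := `|j%:~R * b|; pose d := u - b.
have vu k : k \in s -> d <= `|v0 k| <= u + b.
  move=> /sP[_ /andP[v1 v2] _]; rewrite /d /u.
  have := ler_distD 0 (v0 k) (j%:~R * b); rewrite !subr0 sub0r normrN => H1.
  have := ler_dist_dist (v0 k) (j%:~R * b).
  have H2 : `|v0 k - j%:~R * b| <= b by rewrite ler_norml; apply/andP; split; lra.
  move=> /le_trans/(_ H2); rewrite ler_norml => /andP[H3 H4].
  by apply/andP; split; lra.
have ud : u + E <= t * d.
  have [rv _ _] := sP _ k0s; have /andP[_ vub] := vu _ k0s.
  have : (E + t * b) / (t - 1) <= u by lra.
  by rewrite ler_pdivrMr// /d; lra.
have u0 : 0 <= u by exact: normr_ge0.
have d0 : 0 < d by rewrite -(pmulr_rgt0 _ (lt_trans ltr01 t1)); lra.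
have sz : (size s)%:R <= t * (t * b * (t * d) ^+ m).
  pose a : 'cV[R]_m := const_mx (if (0 <= j)%R then - (u + b) - C else - C).
  apply: (@le_trans _ _ (t * ((b + S) * (u + b + 2 * C + 1 + S) ^+ m))).
    apply: (box (j%:~R * b) a) => //; [exact: ltW|lra| |].
      by move=> k /sP[].
    move=> k ks; apply/in_cubeP => i.
    have [_ jb w0] := sP _ ks.
    have [_ _ /(_ i)[x /andP[x0 x1] qC]] := weight_support q0 (ltW T0) yC w0.
    have {qC} : `|x * v0 k + dsubmx (pt k) i 0| <= C.
      by apply: le_trans qC; rewrite ler_peMl.
    have /andP[_ vub] := vu _ ks.
    move: (dsubmx (pt k) i 0) vub => z vub; rewrite ler_norml => /andP[z1 z2].
    rewrite mxE; case: ifPn => j0.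
      have jb0 : 0 <= j%:~R * b by rewrite mulr_ge0 ?(ltW b0)// ler0z.
      have v00 : 0 <= v0 k by case/andP: jb => + _; exact: le_trans.
      rewrite ger0_norm// in vub.
      have : 0 <= x * v0 k by rewrite mulr_ge0.
      have : x * v0 k <= v0 k by rewrite ler_piMl.
      by move=> *; apply/andP; split; lra.
    have v00 : v0 k <= 0.
      case/andP: jb => _ /ltW/le_trans; apply.
      rewrite -ltNge in j0.
      have : (j + 1)%:~R <= 0 :> R by rewrite lerz0 lezD1.
      by rewrite intrD => j1; rewrite -[X in _ + X]mul1r -mulrDl mulr_le0_ge0 ?(ltW b0).
    rewrite ler0_norm// in vub.
    have : x * v0 k <= 0 by rewrite mulr_ge0_le0.
    have : v0 k <= x * v0 k by rewrite ler_niMl.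
    by move=> *; apply/andP; split; lra.
  rewrite bS ler_pM2l ?(lt_trans ltr01 t1)// ler_wpM2l ?mulr_ge0 ?(ltW b0) ?(le_trans ler01 (ltW t1))//.
  have H : u + b + 2 * C + 1 + S = u + E by rewrite /E; ring.
  by rewrite lerXn2r ?nnegrE ?H ?(le_trans _ ud)// addr_ge0// ltW.
pose M := (q ^ m.+2)%N; have M0 : (0 < M)%N by rewrite expn_gt0 q0.
have M0' : 0 < M%:R :> R by rewrite ltr0n.
have qd0 : 0 < q%:R * d by rewrite mulr_gt0.
have wle k : k \in s -> weight q M y T (pt k) <= (t * T / (q%:R * d)) ^+ m.
  move=> ks; have [_ _ w0] := sP _ ks; have /andP[dv _] := vu _ ks.
  have [_ vq _] := weight_support q0 (ltW T0) yC w0.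
  have v00 : 0 < `|v0 k| by exact: lt_le_trans dv.
  apply: (le_trans (weight_le y q0 M0 (ltW T0) _)); first by rewrite -normr_gt0.
  (* as [|v_0| <= q ^ m * C], the mesh of the grid of shears is negligible *)
  have Mi : M%:R^-1 <= (t - 1) * T / (q%:R * d).
    rewrite ler_pdivlMr// mulrC ler_pdivrMr// [leRHS]mulrC.
    apply: (@le_trans _ _ (q%:R * (q%:R ^+ m * (q%:R * (t - 1) * T)))).
      rewrite ler_pM2l//; apply: (le_trans dv); apply: (le_trans vq).
      by rewrite ler_pM2l// exprn_gt0.
    by rewrite /M natrX !exprS; move: (q%:R ^+ m) => z; lra.
  have tTd0 : 0 <= t * T / (q%:R * d).
    by rewrite divr_ge0 ?mulr_ge0 ?(ltW T0) ?(ltW d0) ?ler0n ?(le_trans ler01 (ltW t1)).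
  have Tv : T / (q%:R * `|v0 k|) <= T / (q%:R * d).
    by rewrite ler_pM2l// lef_pV2 ?posrE ?mulr_gt0// ler_pM2l.
  rewrite lerXn2r ?nnegrE//.
    by rewrite addr_ge0 ?invr_ge0 ?divr_ge0 ?mulr_ge0 ?(ltW T0).
  have -> : t * T / (q%:R * d) = T / (q%:R * d) + (t - 1) * T / (q%:R * d).
    by rewrite -mulrDl; congr (_ / _); ring.
  by rewrite lerD.
apply: (@le_trans _ _ ((size s)%:R * (t * T / (q%:R * d)) ^+ m)).
  rewrite big_seq; apply: (@le_trans _ _ (\sum_(k <- s | k \in s) (t * T / (q%:R * d)) ^+ m)).
    by apply: ler_sum => k; exact: wle.
  by rewrite -big_seq big_const_seq count_predT iter_addr addr0 [leRHS]mulr_natl.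
apply: (@le_trans _ _ (t * (t * b * (t * d) ^+ m) * (t * T / (q%:R * d)) ^+ m)).
  rewrite ler_wpM2r// exprn_ge0// divr_ge0 ?mulr_ge0 ?(ltW T0) ?(ltW d0) ?ler0n//.
  by rewrite (le_trans ler01 (ltW t1)).
have -> : t ^+ 2 * T / q%:R = (t * d) * (t * T / (q%:R * d)).
  by field; rewrite !gt_eqF.
by rewrite [(t * d * (t * T / _)) ^+ m]exprMn expr2 !mulrA.
Qed.

(** The upper half of Siegel's mean value theorem, for the average over shears. The
    vectors with [|v_0| < rho] contribute [O(1 / q)]; the others are grouped into
    about [q^m T / b] slabs of width [b], and each slab contributes about
    [b (T / q)^m]. *)
Lemma mean_weight (Y T eta : R) : 0 < T -> 0 < eta ->
  exists q0 : nat, forall q (y : 'cV[R]_(1 + m)) (s : seq 'cV[int]_(1 + m)),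
    (0 < q)%N -> (q0 <= q)%N -> (forall i, `|y i 0| <= Y) -> uniq s -> 0 \notin s ->
  \sum_(k <- s) weight q (q ^ m.+2) y T (pt k) <= T ^+ m.+1 + eta.
Proof.
move=> T0 eta0; pose C := `|Y| + T.
have TC : T <= C by rewrite lerDr.
have Tm0 : 0 < T ^+ m.+1 by rewrite exprn_gt0.
have [t t1 tm] := @root_gt1 R (1 + eta / (3 * T ^+ m.+1)) (2 * m.+1)
  (ltac:(by rewrite ltrDl divr_gt0// mulr_gt0)).
have t0 : 0 < t := lt_trans ltr01 t1.
have t10 : 0 < t - 1 by rewrite subr_gt0.
have [S S0 box] := size_lattice_box dh t1.
pose b := S / (t - 1); have b0 : 0 < b by rewrite divr_gt0.
have [rho slab] := slab_weight T0 TC t1 S0 (erefl b) box.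
have [A A0 near] := near_weight C rho (ltW T0).
pose B2 := t ^+ (2 * m.+1) * T ^+ m * (2 * b).
have B20 : 0 <= B2.
  apply: mulr_ge0; last by rewrite mulr_ge0// ltW.
  by apply: mulr_ge0; apply: exprn_ge0; exact: ltW.
(* The first summand makes the terms in [1 / q] small, the second one is the
   condition on [q] in [slab_weight]. *)
exists (Num.truncn ((A + B2) * 3 / eta + C / ((t - 1) * T))).+1.
move=> q y s q0 qlarge yY us s0.
have q0' : 0 < q%:R :> R by rewrite ltr0n.
have q1 : 1 <= q%:R :> R by rewrite ler1n.
have C0 : 0 < C by exact: lt_le_trans T0 TC.
have qbig : (A + B2) * 3 / eta + C / ((t - 1) * T) <= q%:R.
  by apply: (le_trans (ltW (truncnS_gt _))); rewrite ler_nat.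
have h1 : 0 <= (A + B2) * 3 / eta.
  by rewrite divr_ge0 ?(ltW eta0)// mulr_ge0// addr_ge0.
have h2 : 0 <= C / ((t - 1) * T).
  by rewrite divr_ge0 ?(ltW C0)// mulr_ge0 ?(ltW t10) ?(ltW T0).
have Cq : C <= q%:R * (t - 1) * T.
  by rewrite -mulrA -ler_pdivrMr ?mulr_gt0//; lra.
have ABq : (A + B2) / q%:R <= eta / 3.
  rewrite ler_pdivrMr// -ler_pdivrMl ?divr_gt0// invf_div mulrC mulrA; lra.
have yC i : `|y i 0| + T <= C.
  by rewrite lerD2r (le_trans (yY i))// ler_norm.
pose M := (q ^ m.+2)%N.
have qM : (q <= M)%N by rewrite -[leqLHS]expn1 leq_pexp2l.
rewrite (bigID (fun k => `|v0 k| < rho))/=.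
have near_le : \sum_(k <- s | `|v0 k| < rho) weight q M y T (pt k) <= A / q%:R.
  rewrite -big_filter; apply: near => //; first exact: filter_uniq.
    by rewrite mem_filter negb_and s0 orbT.
  by move=> k; rewrite mem_filter => /andP[].
have far_le : \sum_(k <- s | ~~ (`|v0 k| < rho)) weight q M y T (pt k) <=
    t ^+ (2 * m.+1) * T ^+ m.+1 + B2 / q%:R.
  rewrite (bigID (fun k => weight q M y T (pt k) == 0))/=.
  rewrite big1 ?add0r; last by move=> k /andP[_ /eqP].
  rewrite -big_filter; set s' := [seq _ <- _ | _].
  have s'P k : k \in s' -> [/\ rho <= `|v0 k|, weight q M y T (pt k) != 0 & k \in s].
    by rewrite mem_filter -leNgt => /andP[/andP[]].
  pose f (k : 'cV[int]_(1 + m)) := Num.floor (v0 k / b).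
  have fP k : (f k)%:~R * b <= v0 k < (f k)%:~R * b + b.
    have /andP[] := floor_itv (v0 k / b); rewrite -/(f k) intrD.
    by rewrite ler_pdivlMr// ltr_pdivrMr// mulrDl mul1r => -> ->.
  apply: (@le_trans _ _ ((size (undup (map f s')))%:R *
      (t ^+ 2 * b * (t ^+ 2 * T / q%:R) ^+ m))).
    apply: sum_fibers => j _; rewrite -big_filter; apply: (slab _ _ _ j) => //.
      by rewrite !filter_uniq.
    move=> k; rewrite mem_filter => /andP[/eqP <- /s'P[]] *.
    by split.
  have qm0 : 0 < q%:R ^+ m :> R by rewrite exprn_gt0.
  have sz : (size (undup (map f s')))%:R <= q%:R ^+ m * T / b + 1 + 1 :> R.
    apply: (@size_int_itv _ _ (q%:R ^+ m * usubmx y 0 0 / b - 1)).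
    - exact: undup_uniq.
    - by rewrite addr_ge0// divr_ge0 ?(ltW b0)// mulr_ge0 ?(ltW qm0) ?(ltW T0).
    move=> j; rewrite mem_undup => /mapP[k /s'P[_ w0 _] ->].
    have [/andP[y1 y2] _ _] := weight_support q0 (ltW T0) yC w0.
    move: y1 y2; rewrite mulrC ler_pdivlMr// ltr_pdivrMr// => y1 y2.
    have /andP[f1 f2] := fP k.
    apply/andP; split.
      rewrite lerBlDr ler_pdivrMr// mulrDl mul1r mulrC.
      exact: (le_trans y1 (ltW f2)).
    have -> : q%:R ^+ m * usubmx y 0 0 / b - 1 + (q%:R ^+ m * T / b + 1) =
        (usubmx y 0 0 + T) * q%:R ^+ m / b by field; rewrite gt_eqF.
    by rewrite ltr_pdivlMr//; apply: le_lt_trans y2.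
  apply: (le_trans (ler_wpM2r _ sz)).
    apply: mulr_ge0; [apply: mulr_ge0; [exact: sqr_ge0|exact: ltW]|apply: exprn_ge0; apply: divr_ge0 => //; apply: mulr_ge0; [exact: sqr_ge0|exact: ltW]].
  have -> : (q%:R ^+ m * T / b + 1 + 1) * (t ^+ 2 * b * (t ^+ 2 * T / q%:R) ^+ m) =
      t ^+ (2 * m.+1) * T ^+ m.+1 + B2 / q%:R ^+ m.
    rewrite /B2 exprM [(t ^+ 2) ^+ m.+1]exprS [T ^+ m.+1]exprS.
    rewrite [(_ / _) ^+ m]exprMn [(t ^+ 2 * T) ^+ m]exprMn exprVn.
    move: ((t ^+ 2) ^+ m) (T ^+ m) => x z; field.
    by rewrite !gt_eqF.
  rewrite lerD2l ler_wpM2l// lef_pV2 ?posrE//.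
  by rewrite -[leLHS]expr1 ler_weXn2l.
apply: (le_trans (lerD near_le far_le)).
have tT : t ^+ (2 * m.+1) * T ^+ m.+1 <= T ^+ m.+1 + eta / 3.
  apply: (le_trans (ler_wpM2r (ltW Tm0) tm)).
  rewrite mulrDl mul1r lerD2l; move: (T ^+ m.+1) Tm0 => z z0.
  by have -> : eta / (3 * z) * z = eta / 3 by field; rewrite gt_eqF.
move: ABq; rewrite mulrDl; lra.
Qed.

End MeanValue.

(** * Averaged miss probabilities *)

(** Take the cubes of a fine grid that meet the smaller ball. *)
Lemma ball_cubes (R : realType) n (rho r : R) : (0 < n)%N -> 0 < rho -> rho < r ->
  exists Delta (W : seq 'cV[int]_n), [/\ 0 < Delta, uniq W, (0 < size W)%N,
    forall w z, w \in W -> cube (Delta *: map_mx intr w) Delta z -> enorm z <= r &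
    kappa R n * rho ^+ n <= (size W)%:R * Delta ^+ n].
Proof.
move=> n0 rho0 rhor.
have r2 : 0 < r ^+ 2 - rho ^+ 2 by nra.
pose Delta := Num.min 1 ((r ^+ 2 - rho ^+ 2) / (n%:R * (2 * rho + 1))).
have n0' : 0 < n%:R :> R by rewrite ltr0n.
have D0 : 0 < Delta by rewrite lt_min ltr01 divr_gt0// mulr_gt0//; lra.
have D1 : Delta <= 1 by rewrite ge_min lexx.
have Dr : n%:R * (2 * rho * Delta + Delta ^+ 2) <= r ^+ 2 - rho ^+ 2.
  have : Delta <= (r ^+ 2 - rho ^+ 2) / (n%:R * (2 * rho + 1)) by rewrite ge_min lexx orbT.
  rewrite ler_pdivlMr ?mulr_gt0//; last by lra.
  apply: le_trans; rewrite mulrCA ler_pM2l//.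
  by rewrite expr2; nra.
have [W0 uW0 W0P] := int_box_seq (rho / Delta + 1) (unitmx1 R n).
pose meet w := `[< exists2 x : 'cV[R]_n, enorm x <= rho & cube (Delta *: map_mx intr w) Delta x >].
have Wcov x : enorm x <= rho -> floor_vec Delta x \in [seq w <- W0 | meet w].
  move=> xrho; have xc := in_cube_floor x D0.
  rewrite mem_filter; apply/andP; split; first by apply/asboolP; exists x.
  apply: W0P => i; rewrite mul1mx.
  have /in_cubeP/(_ i) := xc; have := le_trans (ler_enorm x i) xrho.
  move: (floor_vec _ _) => w; rewrite !mxE ler_norml => /andP[x1 x2] /andP[x3 x4].
  have E : Delta * (rho / Delta) = rho by rewrite mulrC divfK ?gt_eqF.
  rewrite ler_norml; apply/andP; split;
    rewrite -(ler_pM2l D0) ?mulrN mulrDr E mulr1; lra.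
exists Delta, [seq w <- W0 | meet w]; split => //.
- exact: filter_uniq.
- rewrite -has_predT; apply/hasP; exists (floor_vec Delta 0) => //; apply: Wcov.
  by rewrite /enorm big1 ?sqrtr0 ?(ltW rho0)// => i _; rewrite mxE expr0n.
- move=> w z; rewrite mem_filter => /andP[/asboolP[x xrho xw] _] zw.
  have r0 : 0 <= r by apply: ltW; exact: lt_trans rhor.
  rewrite -[leRHS]ger0_norm// -sqrtr_sqr ler_wsqrtr//.
  apply: (@le_trans _ _ (\sum_i (x i 0 ^+ 2 + (2 * rho * Delta + Delta ^+ 2)))).
    apply: ler_sum => i _; have := cube_diff i zw xw; rewrite !mxE.
    have := le_trans (ler_enorm x i) xrho; rewrite ler_norml ltr_norml.
    move: (x i 0) (z i 0) => a c /andP[a1 a2] /andP[c1 c2].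
    have : (c - a) ^+ 2 <= Delta ^+ 2.
      by rewrite -(real_normK (num_real _)) lerXn2r ?nnegrE ?(ltW D0)// ler_norml; lra.
    have : a * (c - a) <= rho * Delta.
      apply: (le_trans (ler_norm _)); rewrite normrM; apply: ler_pM => //;
        rewrite ler_norml; lra.
    by rewrite !expr2; nra.
  rewrite big_split/= sumr_const card_ord -mulr_natl.
  have : \sum_i x i 0 ^+ 2 <= rho ^+ 2.
    rewrite -[leLHS]sqr_sqrtr; last by apply: sumr_ge0 => i _; exact: sqr_ge0.
    by rewrite lerXn2r ?nnegrE ?(ltW rho0) ?sqrtr_ge0.
  by lra.
- rewrite -lee_fin; apply: (le_trans (volume_ball_ge n0 rho0)).
  set W := [seq w <- W0 | meet w].
  have -> : (size W)%:R * Delta ^+ n = \sum_(p <- [seq (Delta *: map_mx intr w,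
      Delta *: map_mx intr w + const_mx Delta) | w <- W]) box_volume p.1 p.2.
    rewrite big_map (eq_bigr (fun=> Delta ^+ n)).
      by rewrite big_const_seq count_predT iter_addr addr0 mulr_natl.
    move=> w _; rewrite /box_volume/= (eq_bigr (fun=> Delta)) ?prodr_const ?card_ord//.
    by move=> i _ /=; rewrite !mxE; ring.
  apply: volume_le_boxes => //.
    by move=> _ /mapP[w _ ->] i /=; rewrite !mxE lerDl ltW.
  move=> x /= xrho; exists (Delta *: map_mx intr (floor_vec Delta x),
      Delta *: map_mx intr (floor_vec Delta x) + const_mx Delta).
    by apply/mapP; exists (floor_vec Delta x) => //; exact: Wcov.
  move=> i /=; have /in_cubeP/(_ i) := in_cube_floor x D0.
  by move: (floor_vec _ _) => w; rewrite !mxE => /andP[-> /ltW ->].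
Qed.

Lemma lattice_act_basis (R : realType) n (g : SL R n) (L : lattice R n) (h : 'M[R]_n) :
  lattice_points L = lattice_of h ->
  lattice_points (lattice_act g L) = lattice_of (\val g *m h).
Proof.
move=> /= ->; apply/seteqP; split=> [_ [_ [k _ <-] <-]|_ [k _ <-]].
  by exists k; rewrite // mulmxA.
by exists (h *m map_mx intr k); [exists k | rewrite mulmxA].
Qed.

Section Averaging.
Variables (R : realType) (m : nat).
Hypothesis m0 : (0 < m)%N.
Local Notation n := (1 + m)%N.

Lemma shear_in_SL q M (x : {ffun 'I_m -> 'I_M}) : (shear R q.+1 x) \in SL R n.
Proof. by apply/mem_set; exact: det_shear. Qed.

Definition sl_shear q M (x : {ffun 'I_m -> 'I_M}) : SL R n :=
  exist _ (shear R q.+1 x) (shear_in_SL q x).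

Variables (Delta : R) (W : seq 'cV[int]_n).
Hypothesis Delta0 : 0 < Delta.
Hypothesis uW : uniq W.
Hypothesis W0 : (0 < size W)%N.
Let Vol := (size W)%:R * Delta ^+ n.

Variables (nu : forall L : lattice R n, probability (borel_torus L) R).
Hypothesis nuH : forall L, torus_haar (nu L).
Variable B : forall L : lattice R n, set (borel_torus L).
Hypothesis mB : forall L, measurable (@B L).
Hypothesis Bmiss : forall L (t : borel_torus L) z w, @B L t -> w \in W ->
  torus_points t z -> ~ cube (Delta *: map_mx intr w) Delta z.

(** Average [nu_miss_le] over the shears, with the same grid for all of them, and
    exchange the sums: [mean_weight] bounds each inner sum by about [T^n], where
    [T] is close to [Delta]. After division by the square of the volume the pairs
    of cubes contribute at most [1 + eps], which cancels the term [- 1]. *)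
Lemma shear_average_le (L : lattice R n) (eps : R) : 0 < eps ->
  exists q0 : nat, forall q M, (q0 <= q)%N -> M = (q.+1 ^ m.+2)%N ->
    (M%:R ^+ m)^-1 * (\sum_(x : {ffun 'I_m -> 'I_M})
       fine (nu (lattice_act (sl_shear q x) L) (@B (lattice_act (sl_shear q x) L)))) <=
    Vol^-1 + eps.
Proof.
move=> eps0; have [h dh Lh] := lattice_basis L.
have Dn0 : 0 < Delta ^+ n by rewrite exprn_gt0.
have Vol0 : 0 < Vol by rewrite mulr_gt0 ?ltr0n.
have [th th1 thn] := @root_gt1 R (1 + eps / 2) n (ltac:(by rewrite ltrDl divr_gt0)).
have th10 : 0 < th - 1 by rewrite subr_gt0.
pose T := Delta * th.
have T0 : 0 < T by rewrite mulr_gt0// (lt_trans ltr01).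
pose eta := Delta ^+ n * (eps / 2).
have eta0 : 0 < eta by rewrite mulr_gt0// divr_gt0.
pose b := \sum_(w <- W) entry_norm (map_mx intr w : 'cV[R]_n).
have b0 : 0 <= b by apply: sumr_ge0 => w _; exact: entry_norm_ge0.
have wb w i : w \in W -> `|(w i 0)%:~R| <= b :> R.
  move=> wW; rewrite /b (bigD1_seq w)//=.
  rewrite /entry_norm (bigD1 i)//= big_ord1 !mxE -!addrA lerDl.
  rewrite addr_ge0//; first by apply: sumr_ge0 => j _; apply: sumr_ge0.
  by apply: sumr_ge0 => w' _; exact: entry_norm_ge0.
pose Y := Delta * (2 * b + 2).
have [q0 q0P] := mean_weight dh m0 Y T0 eta0.
exists q0 => q M qq0 ME.
have M0 : (0 < M)%N by rewrite ME expn_gt0.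
have M0' : 0 < M%:R ^+ m :> R by rewrite exprn_gt0// ltr0n.
pose X := {ffun 'I_m -> 'I_M}.
pose gh (x : X) := shear R q.+1 x *m h.
have dgh x : \det (gh x) = 1 by rewrite det_mulmx det_shear// mul1r.
have Lgh (x : X) : lattice_points (lattice_act (sl_shear q x) L) = lattice_of (gh x).
  exact: lattice_act_basis.
(* [K] must suit all of the finitely many lattices, to exchange the sums below. *)
have [K [K0 sK Kth]] : exists K : nat, [/\ (0 < K)%N,
    forall x : X, small (gh x) (2 * (Delta / K%:R)) & Delta / K%:R <= Delta * (th - 1)].
  have /boolp.choice[s sP] (x : X) : exists s : R, 0 < s /\ small (gh x) s.
    by have [s s0 ss] := exists_small (dgh x); exists s.
  pose K1 := (\max_(x : X) (Num.truncn (2 * Delta / s x)).+1)%N.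
  exists (maxn K1 (Num.truncn (th - 1)^-1).+1); split.
  - by rewrite (leq_trans _ (leq_maxr _ _)).
  - move=> x; have [s0 ss] := sP x; apply: small_le ss.
    rewrite mulrA ler_pdivrMr ?ltr0n ?(leq_trans _ (leq_maxr _ _))//.
    rewrite -ler_pdivrMl// mulrC; apply: (le_trans (ltW (truncnS_gt _))).
    rewrite ler_nat (leq_trans _ (leq_maxl _ _))//.
    exact: (leq_bigmax_cond (F := fun x => (Num.truncn (2 * Delta / s x)).+1)).
  - rewrite ler_pM2l// invf_ple ?posrE ?ltr0n ?(leq_trans _ (leq_maxr _ _))//.
    apply: (le_trans (ltW (truncnS_gt _))); rewrite ler_nat leq_maxr//.
have K0' : 0 < K%:R :> R by rewrite ltr0n.
pose delta := Delta / K%:R; have delta0 : 0 < delta by rewrite divr_gt0.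
have /boolp.choice[bxx bxxP] (x : X) : exists s : seq 'cV[int]_n,
    forall k, (forall i, `|(gh x *m map_mx intr k) i 0| <= 2 * (Delta * (b + 1))) -> k \in s.
  have ghu : gh x \in unitmx by rewrite unitmxE dgh unitr1.
  by have [s _ sP] := int_box_seq (2 * (Delta * (b + 1))) ghu; exists s.
pose bx := undup [seq k <- flatten [seq bxx x | x <- index_enum X] | k != 0].
have ubx : uniq bx by exact: undup_uniq.
have bx0 : 0 \notin bx by rewrite mem_undup mem_filter eqxx.
have cube_bound w z i : w \in W -> cube (Delta *: map_mx intr w) Delta z ->
    `|z i 0| <= Delta * (b + 1).
  move=> wW /in_cubeP/(_ i); have := wb w i wW; rewrite !mxE ler_norml => /andP[w1 w2].
  have := ler_wpM2l (ltW Delta0) w1; have := ler_wpM2l (ltW Delta0) w2.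
  move=> a1 a2 /andP[a3 a4]; rewrite ler_norml; apply/andP; split; lra.
have bxP (x : X) k z : k != 0 ->
  (exists2 w, w \in W & cube (Delta *: map_mx intr w) Delta z) ->
  (exists2 w, w \in W &
     cube (Delta *: map_mx intr w) Delta (z + gh x *m map_mx intr k)) -> k \in bx.
  move=> k0 [w wW zw] [w' w'W zw']; rewrite mem_undup mem_filter k0 /=.
  apply/flattenP; exists (bxx x); first by rewrite map_f// mem_index_enum.
  apply: bxxP => i; have := cube_bound _ _ i wW zw; have := cube_bound _ _ i w'W zw'.
  move: (_ *m _) => u; rewrite !mxE => a1 a2.
  have -> : u i 0 = (z i 0 + u i 0) - z i 0 by rewrite addrC addKr.
  by apply: (le_trans (ler_normB _ _)); rewrite mulr_natl mulr2n lerD.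
pose y w e w' : 'cV[R]_n := Delta *: map_mx intr w' -
  @grid_pt R n K (Delta *: map_mx intr w) delta e - const_mx delta.
have yY w e w' i : w \in W -> w' \in W -> `|y w e w' i 0| <= Y.
  move=> wW w'W; have := wb w i wW; have := wb w' i w'W.
  rewrite !mxE !ler_norml => /andP[a1 a2] /andP[a3 a4].
  have := ler_wpM2l (ltW Delta0) a1; have := ler_wpM2l (ltW Delta0) a2.
  have := ler_wpM2l (ltW Delta0) a3; have := ler_wpM2l (ltW Delta0) a4.
  have e0 : 0 <= delta * (e i)%:R by rewrite mulr_ge0// ltW.
  have e1 : delta * (e i)%:R + delta <= Delta.
    have : delta * (e i).+1%:R <= delta * K%:R by rewrite ler_pM2l// ler_nat.
    by rewrite -[(e i).+1]addn1 natrD mulrDr mulr1 /delta divfK// gt_eqF.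
  by move=> *; apply/andP; split; rewrite /Y; lra.
pose S (x : X) : R := \sum_(w <- W) \sum_(e : {ffun 'I_n -> 'I_K})
  delta ^+ n * \sum_(w' <- W) \sum_(k <- bx)
    (in_cube (y w e w') T (gh x *m map_mx intr k))%:R.
have le1 (x : X) : fine (nu (lattice_act (sl_shear q x) L)
    (@B (lattice_act (sl_shear q x) L))) <= Vol^-1 - 1 + Vol ^- 2 * S x.
  have := nu_miss_le (Lgh x) (dgh x) (@nuH _) Delta0 uW W0 K0 (sK x) (bxP x) (@mB _)
    (@Bmiss (lattice_act (sl_shear q x) L)).
  move=> /le_trans; apply; rewrite lerD2l ler_wpM2l ?invr_ge0 ?exprn_ge0 ?(ltW Vol0)//.
  apply: ler_sum => w _; apply: ler_sum => e _.
  rewrite ler_wpM2l ?exprn_ge0 ?(ltW delta0)//.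
  apply: ler_sum => w' _; apply: ler_sum => k _.
  have : in_cube (y w e w') (Delta + delta) (gh x *m map_mx intr k) ->
      in_cube (y w e w') T (gh x *m map_mx intr k).
    move=> /in_cubeP H; apply/in_cubeP => i; have := H i; rewrite /T.
    by move: Kth; rewrite -/delta; lra.
  rewrite -/(y w e w'); case: (in_cube _ (Delta + delta) _) => [->//|_].
  by rewrite ler0n.
have T_n : 0 <= T ^+ n by rewrite exprn_ge0 ?(ltW T0).
have sumS : (M%:R ^+ m)^-1 * \sum_(x : X) S x <= Vol * (size W)%:R * (T ^+ n + eta).
  have -> : (M%:R ^+ m)^-1 * \sum_(x : X) S x =
      \sum_(w <- W) \sum_(e : {ffun 'I_n -> 'I_K})
      delta ^+ n * \sum_(w' <- W) \sum_(k <- bx)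
        weight q.+1 M (y w e w') T (h *m map_mx intr k).
    rewrite exchange_big mulr_sumr; apply: eq_bigr => w _.
    rewrite exchange_big mulr_sumr; apply: eq_bigr => e _.
    rewrite -mulr_sumr mulrCA; congr (_ * _).
    rewrite exchange_big mulr_sumr; apply: eq_bigr => w' _.
    rewrite exchange_big mulr_sumr; apply: eq_bigr => k _.
    by rewrite /weight; congr (_ * _); apply: eq_bigr => x _; rewrite mulmxA.
  apply: (@le_trans _ _ (\sum_(w <- W) \sum_(e : {ffun 'I_n -> 'I_K})
      delta ^+ n * \sum_(w' <- W) (T ^+ n + eta))).
    rewrite big_seq [leRHS]big_seq; apply: ler_sum => w wW; apply: ler_sum => e _.
    rewrite ler_wpM2l ?exprn_ge0 ?(ltW delta0)//.
    rewrite big_seq [leRHS]big_seq; apply: ler_sum => w' w'W.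
    rewrite ME; apply: (q0P q.+1) => //; [exact: leqW|by move=> i; exact: yY].
  rewrite (eq_bigr (fun=> Delta ^+ n * ((size W)%:R * (T ^+ n + eta)))).
    rewrite big_const_seq count_predT iter_addr addr0 -[leLHS]mulr_natl /Vol.
    by rewrite !mulrA.
  move=> w _; rewrite sum_grid_const mulrA -exprMn [_ * delta]mulrC.
  rewrite [delta * _]divfK ?gt_eqF//; congr (_ * _).
  by rewrite big_const_seq count_predT iter_addr addr0 [RHS]mulr_natl.
rewrite mulrC ler_pdivrMr//.
apply: (@le_trans _ _ (\sum_(x : X) (Vol^-1 - 1 + Vol ^- 2 * S x))).
  by apply: ler_sum => x _; exact: le1.
rewrite big_split/= sum_grid_const -mulr_sumr.
have {}sumS : \sum_(x : X) S x <= M%:R ^+ m * (Vol * (size W)%:R * (T ^+ n + eta)).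
  by rewrite -ler_pdivrMl.
apply: (@le_trans _ _ (M%:R ^+ m * (Vol^-1 - 1 +
    Vol ^- 2 * (Vol * (size W)%:R * (T ^+ n + eta))))).
  by rewrite [leRHS]mulrDr lerD2l mulrCA ler_wpM2l// invr_ge0 exprn_ge0 ?(ltW Vol0).
rewrite [leLHS]mulrC ler_pM2r//.
have -> : Vol ^- 2 * (Vol * (size W)%:R * (T ^+ n + eta)) = th ^+ n + eps / 2.
  rewrite /Vol /T /eta [(Delta * th) ^+ n]exprMn; move: (Delta ^+ n) (th ^+ n) Dn0 => a c a0.
  by field; rewrite gt_eqF//= pnatr_eq0 -lt0n.
lra.
Qed.

End Averaging.

(** * The second bound *)

Section Invariance.
Variables (R : realType) (n : nat).

Lemma measurable_lattice_act (g : SL R n) :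
  measurable_fun [set: X R n] (lattice_act g : X R n -> X R n).
Proof.
apply: (@measurability _ _ (X R n) (X R n) setT _ (quotient_opens (@lattice_proj R n))) => //.
move=> _ [U oU <-]; rewrite setTI; apply: sub_sigma_algebra.
have [V oV VE] : exists2 V : set 'M[R]_n, open V &
  set_val @^-1` V = @lattice_proj R n @^-1` U by exact: oU.
rewrite /quotient_opens/=.
suff : exists2 V' : set 'M[R]_n, open V' &
  set_val @^-1` V' = @lattice_proj R n @^-1` (lattice_act g @^-1` U) by exact.
exists ((fun h => \val g *m h) @^-1` V).
  apply: open_comp => // h _; apply: continuous_mx => i j {}h.
  under eq_fun do rewrite !mxE; apply: continuous_sum => k {}h.
  by apply: continuousM; [exact: cst_continuous|exact: coord_continuous].
have ghS (h : SL R n) : \val g *m \val h \in SL R n.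
  by apply/mem_set; rewrite /SL/= det_mulmx !SL_val mulr1.
have ghE (h : SL R n) : lattice_proj (exist _ (\val g *m \val h) (ghS h) : SL R n) =
    lattice_act g (lattice_proj h).
  by apply: lattice_ext; apply/esym; exact: (@lattice_act_basis R n g (lattice_proj h) _ erefl).
rewrite [RHS](_ : _ = [set h | (@lattice_proj R n @^-1` U)
    (exist _ (\val g *m \val h) (ghS h) : SL R n)]).
  by rewrite -VE.
by apply/seteqP; split=> h /=; rewrite ghE.
Qed.

Lemma integral_lattice_act (mu : probability (X R n) R) (f : X R n -> \bar R) (g : SL R n) :
  lattice_haar mu -> measurable_fun [set: X R n] f -> (forall L, (0 <= f L)%E) ->
  (\int[mu]_L f (lattice_act g L) = \int[mu]_L f L)%E.
Proof.
move=> muH mf f0.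
have := ge0_integral_pushforward (measurable_lattice_act g) mu measurableT mf (fun y _ => f0 y).
rewrite preimage_setT => <-.
rewrite (eq_measure_integral mu) => [//||? A mA _]; first exact: measurable_lattice_act.
exact: (muH g A mA).
Qed.

End Invariance.

Section SecondHalf.
Variables (R : realType) (m : nat).
Hypothesis m0 : (0 < m)%N.
Local Notation n := (1 + m)%N.

(** By invariance, the probability is the integral of the averages over shears for
    each [q]. These are bounded by 1 and, by [shear_average_le], eventually below
    the bound at every lattice, so dominated convergence applies to their maximum
    with the bound. *)
Lemma prob_miss_cubes (P : probability (Xaff R n) R) (A : set (Xaff R n))
    (Delta : R) (W : seq 'cV[int]_n) :
    affine_haar P -> measurable A -> 0 < Delta -> uniq W -> (0 < size W)%N ->
    (forall S z w, A S -> w \in W -> affine_points S z ->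
       ~ cube (Delta *: map_mx intr w) Delta z) ->
  (P A <= (((size W)%:R * Delta ^+ n)^-1)%:E)%E.
Proof.
move=> [mu [nu [muH nuH Pint]]] mA D0 uW W0 Amiss.
have [mc ->] := Pint _ mA.
pose B (L : lattice R n) : set (borel_torus L) := [set t | A (existT _ L t)].
have mB L : measurable (B L) by exact: measurable_slice_set.
have Bmiss L (t : borel_torus L) z w : B L t -> w \in W -> torus_points t z ->
    ~ cube (Delta *: map_mx intr w) Delta z.
  by move=> BLt wW tz; apply: (Amiss (existT _ L t) z w).
pose cond (L : X R n) : \bar R := nu L (B L).
rewrite -/cond in mc *.
have cond_fin L : (fine (cond L))%:E = cond L by rewrite fineK// fin_num_measure.
have cond0 L : (0 <= cond L)%E by exact: measure_ge0.
have cond1 L : (cond L <= 1)%E by exact: probability_le1.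
apply/lee_addgt0Pr => eps eps0; rewrite -EFinD.
set beta := (_^-1 + eps).
pose M q := (q.+1 ^ m.+2)%N.
pose c q : R := ((M q)%:R ^+ m)^-1.
have Mm0 q : 0 < (M q)%:R ^+ m :> R by rewrite exprn_gt0// ltr0n expn_gt0.
have c0 q : 0 <= c q by rewrite invr_ge0 ltW.
pose F q (L : X R n) : \bar R := ((c q)%:E *
  \sum_(x : {ffun 'I_m -> 'I_(M q)}) cond (lattice_act (sl_shear R q x) L))%E.
have FE q L : F q L = (c q * \sum_(x : {ffun 'I_m -> 'I_(M q)})
    fine (cond (lattice_act (sl_shear R q x) L)))%:E.
  by rewrite /F EFinM -sumEFin; congr (_ * _)%E; apply: eq_bigr => x _.
have mact q (x : {ffun 'I_m -> 'I_(M q)}) :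
    measurable_fun [set: X R n] (fun L => cond (lattice_act (sl_shear R q x) L)).
  exact: (measurableT_comp mc (measurable_lattice_act (sl_shear R q x))).
have msum q : measurable_fun [set: X R n] (fun L => \sum_(x : {ffun 'I_m -> 'I_(M q)})
    cond (lattice_act (sl_shear R q x) L))%E.
  by apply: emeasurable_sum => x; exact: mact.
have mF q : measurable_fun [set: X R n] (F q) by apply: measurable_funeM; exact: msum.
have intF q : (\int[mu]_L F q L = \int[mu]_L cond L)%E.
  have intsum : (\int[mu]_L (\sum_(x : {ffun 'I_m -> 'I_(M q)})
      cond (lattice_act (sl_shear R q x) L)) =
      \sum_(x : {ffun 'I_m -> 'I_(M q)}) \int[mu]_L cond L)%E.
    rewrite ge0_integral_sum//.
    by apply: eq_bigr => x _; exact: (integral_lattice_act _ muH mc cond0).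
  rewrite /F ge0_integralZl ?lee_fin//; last first.
    by move=> L _; apply: sume_ge0 => x _; exact: cond0.
  rewrite intsum -(Pint _ mA).2 -[P A]fineK ?fin_num_measure// sumEFin -EFinM.
  by rewrite sum_grid_const mulrA mulVf ?gt_eqF// mul1r.
have F1 q L : (F q L <= 1)%E.
  rewrite FE lee_fin mulrC ler_pdivrMr// mul1r -[leRHS]mulr1 -sum_grid_const.
  by apply: ler_sum => x _; rewrite -lee_fin cond_fin.
have F0 q L : (0 <= F q L)%E.
  by rewrite /F mule_ge0 ?lee_fin// sume_ge0.
have beta0 : 0 <= beta.
  by rewrite addr_ge0 ?(ltW eps0)// invr_ge0 mulr_ge0// exprn_ge0// ltW.
(* The maximum converges, whereas [F q L] itself is only bounded above in the limit. *)
pose f q (L : X R n) : \bar R := maxe beta%:E (F q L).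
have mf q : measurable_fun [set: X R n] (f q).
  by apply: measurable_maxe => //; exact: measurable_cst.
have flim L : f q L @[q --> \oo] --> beta%:E.
  have [q0 q0P] := shear_average_le m0 D0 uW W0 nuH mB Bmiss L eps0.
  apply: cvg_near_cst; near=> q.
  rewrite /f; apply/max_idPl; rewrite FE lee_fin; apply: q0P => //.
  by near: q; exact: nbhs_infty_ge.
have dom : (\int[mu]_L f q L)%E @[q --> \oo] --> (\int[mu]_L beta%:E)%E.
  apply: (@dominated_cvg _ _ _ mu setT measurableT f (cst beta%:E)
    (cst (Num.max beta 1)%:E)) => //.
    by apply: finite_measure_integrable_cst.
  move=> q L _; rewrite gee0_abs /f /cst/=; last by rewrite le_max lee_fin beta0.
  rewrite EFin_max ge_max le_max lexx/= (le_trans (F1 q L))//.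
  by rewrite le_max lexx orbT.
have -> : beta%:E = (\int[mu]_L beta%:E)%E.
  by rewrite (integral_cst mu measurableT) [X in (_ * X)%E]probability_setT mule1.
rewrite -(cvg_lim _ dom)//.
apply: lime_ge; first by apply/cvg_ex; eexists; exact: dom.
near=> q; rewrite -(intF q); apply: ge0_le_integral => // L _.
by rewrite /f le_max lexx orbT.
Unshelve. all: by end_near. Qed.

(** Apply [prob_miss_cubes] to cubes that fill most of the ball of volume [t]. *)
Lemma prob_U_gt (P : probability (Xaff R n) R) (t : R) : affine_haar P -> 0 < t ->
  (P [set S | (t < U_aff S)%R] <= (1 / t)%:E)%E.
Proof.
move=> PH t0; have [mu [nu [_ nuH _]]] := PH.
have k0 : 0 < kappa R n by exact: (kappa_gt0 _ (nuH point)).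
pose r := (t / kappa R n) `^ (n%:R^-1).
have r0 : 0 < r by rewrite powR_gt0// divr_gt0.
have rE : kappa R n * r ^+ n = t.
  rewrite /r -powR_mulrn ?powR_ge0// -powRrM mulVf ?pnatr_eq0//.
  by rewrite powRr1 ?divr_ge0 ?(ltW t0) ?(ltW k0)// mulrC divfK ?gt_eqF.
have mA : measurable ([set S | (t < U_aff S)%R] : set (Xaff R n)).
  have := @measurable_U_itv R n `]t, +oo[.
  by congr (measurable _); apply/seteqP; split=> S /=; rewrite in_itv/= andbT.
rewrite -[leLHS]fineK ?fin_num_measure// lee_fin div1r.
apply: (@le_of_forall_root _ _ _ n); first by rewrite invr_ge0 ltW.
move=> th th1; have th0 : 0 < th := lt_trans ltr01 th1.
have rho0 : 0 < r / th by rewrite divr_gt0.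
have rhor : r / th < r by rewrite ltr_pdivrMr// ltr_pMr.
have [Delta [W [D0 uW W0 Wr kV]]] := ball_cubes (ltn0Sn _ : (0 < n)%N) rho0 rhor.
have V0 : 0 < (size W)%:R * Delta ^+ n by rewrite mulr_gt0 ?exprn_gt0// ltr0n.
apply: (@le_trans _ _ ((size W)%:R * Delta ^+ n)^-1).
  rewrite -lee_fin fineK ?fin_num_measure//.
  apply: prob_miss_cubes => // S z w /= tU wW Sz zw.
  move: tU; apply/negP; rewrite -leNgt -rE /U_aff ler_pM2l// lerXn2r ?nnegrE ?(ltW r0)//.
    by have [z' _ [-> _]] := rho_aff_min S; exact: enorm_ge0.
  by apply/rho_aff_le; exists z => //; exact: (Wr w).
have -> : th ^+ n * t^-1 = (kappa R n * (r / th) ^+ n)^-1.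
  rewrite -rE exprMn exprVn; move: (th ^+ n) (r ^+ n) (exprn_gt0 n th0) (exprn_gt0 n r0) => a c a0 c0.
  by field; rewrite !gt_eqF.
by rewrite lef_pV2 ?posrE// mulr_gt0// exprn_gt0.
Qed.

End SecondHalf.

(** * Concentration *)

Lemma prob_U_bounds (R : realType) (n : nat) (P : probability (Xaff R n) R) (u t : R) :
  (2 <= n)%N -> affine_haar P -> 0 < u -> 0 < t ->
  (P [set S | (U_aff S <= u)%R] <= u%:E)%E /\
  (P [set S | (t < U_aff S)%R] <= (1 / t)%:E)%E.
Proof.
case: n P => [|[|m]]// P _ PH u0 t0; split; first exact: prob_U_le.
exact: (@prob_U_gt R m.+1 _ P t).
Qed.

Lemma expR_half_le (R : realType) (x : R) : 0 <= x <= 1 -> expR (x / 2) <= 1 + x.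
Proof.
move=> /andP[x0 x1]; have := expR_ge1Dx (- (x / 2)); rewrite expRN => H.
have e0 := expR_gt0 (x / 2).
have : expR (x / 2) * (1 - x / 2) <= 1.
  by rewrite -ler_pdivlMl// mulr1.
by move: (expR _) e0 {H} => e e0 H; nra.
Qed.

Lemma ln_bounds (R : realType) (n : nat) : (256 <= n)%N ->
  2 <= ln (n%:R : R) /\ ln (n%:R : R) <= n%:R / 8.
Proof.
move=> n256; have n0 : 0 < n%:R :> R by rewrite ltr0n (leq_trans _ n256).
have n256' : 256 <= n%:R :> R by rewrite ler_nat.
split.
  rewrite -ler_expR lnK ?posrE//; apply: le_trans n256'.
  have := @expR_half_le R 1; rewrite lexx ler01 => /(_ isT) h.
  rewrite (_ : expR 2 = expR (1 / 2) ^+ 4); last by rewrite -expRM_natl; congr expR; field.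
  apply: (@le_trans _ _ (2 ^+ 4)).
    by rewrite lerXn2r ?nnegrE ?expR_ge0//; lra.
  by rewrite -natrX ler_nat.
rewrite -ler_expR lnK ?posrE//.
have := expR_ge1Dx (n%:R / 8 / 2 : R) => h.
rewrite (_ : expR (n%:R / 8) = expR (n%:R / 8 / 2 : R) ^+ 2); last first.
  by rewrite -expRM_natl; congr expR; field.
apply: (@le_trans _ _ ((1 + n%:R / 8 / 2) ^+ 2)).
  by rewrite expr2; nra.
by rewrite lerXn2r ?nnegrE ?expR_ge0//; lra.
Qed.

(** By the choice of [Rstar], the ball of radius [c * Rstar] has volume [c^n]. *)
Lemma prob_rho_concentrated (R : realType) (n : nat) (P : probability (Xaff R n) R) (x : R) :
  (2 <= n)%N -> affine_haar P -> 0 < x < 1 ->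
  ((1 - 2 * expR (- (n%:R * (x / 2))))%:E <=
    P [set S | ((1 - x) * Rstar R n <= rho_aff S <= (1 + x) * Rstar R n)%R])%E.
Proof.
move=> n2 PH /andP[x0 x1]; have n0 : (0 < n)%N by exact: leq_trans n2.
have k0 : 0 < kappa R n.
  by have [mu [nu [_ nuH _]]] := PH; exact: (kappa_gt0 n0 (nuH point)).
have R0 : 0 < Rstar R n by rewrite powR_gt0.
have Rk : kappa R n * Rstar R n ^+ n = 1.
  rewrite /Rstar -powR_mulrn ?powR_ge0// -powRrM mulNr mulVf ?pnatr_eq0 -?lt0n//.
  by rewrite powR_inv1 ?(ltW k0)// divff ?gt_eqF.
have kE c : c ^+ n = kappa R n * (c * Rstar R n) ^+ n.
  by rewrite exprMn mulrCA Rk mulr1.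
have y0 : 0 < 1 - x by rewrite subr_gt0.
have z0 : 0 < 1 + x by lra.
have [Plow _] := prob_U_bounds n2 PH (exprn_gt0 n y0) ltr01.
have [_ Phigh] := prob_U_bounds n2 PH ltr01 (exprn_gt0 n z0).
set G := [set S | _].
have mG : measurable (G : set (Xaff R n)).
  have := @measurable_rho_itv R n `[(1 - x) * Rstar R n, (1 + x) * Rstar R n].
  by congr (measurable _); apply/seteqP; split=> S /=; rewrite in_itv.
pose A1 := [set S : Xaff R n | (U_aff S <= (1 - x) ^+ n)%R].
pose A2 := [set S : Xaff R n | ((1 + x) ^+ n < U_aff S)%R].
have mA1 : measurable A1.
  have := @measurable_U_itv R n `]-oo, (1 - x) ^+ n].
  by congr (measurable _); apply/seteqP; split=> S /=; rewrite in_itv.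
have mA2 : measurable A2.
  have := @measurable_U_itv R n `](1 + x) ^+ n, +oo[.
  by congr (measurable _); apply/seteqP; split=> S /=; rewrite in_itv/= andbT.
have GA : ~` G `<=` A1 `|` A2.
  move=> S /= /negP; rewrite negb_and -!ltNge => /orP[lt1|lt2]; [left|right].
    rewrite /A1 /= /U_aff [leRHS]kE ler_pM2l// lerXn2r ?nnegrE ?(ltW lt1)//.
      by have [z' _ [-> _]] := rho_aff_min S; exact: enorm_ge0.
    by rewrite mulr_ge0 ?(ltW R0) ?(ltW y0).
  rewrite /A2 /= /U_aff [ltLHS]kE ltr_pM2l// ltrXn2r -?lt0n ?n0 ?lt2//.
  by rewrite mulr_ge0 ?(ltW R0) ?(ltW z0).
have PG : (P (~` G) <= ((1 - x) ^+ n + 1 / (1 + x) ^+ n)%:E)%E.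
  apply: (@le_trans _ _ (P (A1 `|` A2))).
    by apply: le_measure; [apply: mem_set; exact: measurableC|apply: mem_set; exact: measurableU|].
  apply: (@le_trans _ _ (P A1 + P A2)%E); first exact: measureU2.
  by rewrite EFinD; exact: leeD.
have b1 : (1 - x) ^+ n <= expR (- (n%:R * (x / 2))).
  rewrite -mulrN expRM_natl lerXn2r ?nnegrE ?expR_ge0 ?(ltW y0)//.
  by apply: le_trans (expR_ge1Dx _); lra.
have b2 : 1 / (1 + x) ^+ n <= expR (- (n%:R * (x / 2))).
  rewrite expRN div1r lef_pV2 ?posrE ?exprn_gt0 ?expR_gt0//.
  rewrite expRM_natl lerXn2r ?nnegrE ?expR_ge0 ?(ltW z0)//.
  by apply: expR_half_le; rewrite !ltW.
have -> : P G = (1 - P (~` G))%E.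
  by rewrite -probability_setC ?setCK//; exact: measurableC.
have finG : P (~` G) \is a fin_num by rewrite fin_num_measure//; exact: measurableC.
move: PG; rewrite -(fineK finG) lee_fin => PG.
by rewrite -EFinB lee_fin lerD2l lerN2; apply: (le_trans PG); lra.
Qed.

Theorem proposition6p9 (R : realType) :
  (forall (n : nat) (P : probability (Xaff R n) R),
     (2 <= n)%N -> affine_haar P ->
     forall u t : R, 0 < u -> 0 < t ->
       (P [set S | (U_aff S <= u)%R] <= u%:E)%E /\
       (P [set S | (t < U_aff S)%R] <= (1 / t)%:E)%E) /\
  (exists a : R, 0 < a /\ exists N : nat,
     forall (n : nat) (P : probability (Xaff R n) R),
       (2 <= n)%N -> (N <= n)%N -> affine_haar P ->
       let l : R := (Num.ceil (ln (n%:R : R)))%:~R in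
       ((1 - expR (- (a * n%:R / ln (n%:R : R))))%:E <=
          P [set S | ((1 - 1 / l) * Rstar R n <= rho_aff S
                        <= (1 + 1 / l) * Rstar R n)%R])%E).
Proof.
split; first by move=> n P n2 PH u t; exact: prob_U_bounds.
exists (1 / 8); split; first by lra.
exists 256%N => n P n2 n256 PH; cbv zeta.
set l : R := (Num.ceil _)%:~R.
have [ln2 ln8] := @ln_bounds R n n256.
have ll : ln n%:R <= l by exact: ceil_ge.
have lu : l <= 2 * ln n%:R.
  have /andP[] := ceil_itv (ln (n%:R : R)); rewrite intrB => + _.
  by rewrite -/l; lra.
have l0 : 0 < l by lra.
have x01 : 0 < 1 / l < 1 by rewrite divr_gt0//= ltr_pdivrMr//; lra.
apply: le_trans (prob_rho_concentrated n2 PH x01); rewrite lee_fin lerD2l lerN2.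
have lnp : 0 < ln (n%:R : R) by lra.
pose z : R := n%:R / (8 * ln n%:R).
(* this is where [256 <= n] enters, and it gives [2 <= expR z] *)
have z1 : 1 <= z by rewrite ler_pdivlMr ?mulr_gt0//; lra.
have zE : 1 / 8 * n%:R / ln n%:R = z by rewrite /z; field; rewrite gt_eqF.
have xz : 2 * z <= n%:R * (1 / l / 2).
  have -> : 2 * z = n%:R * (1 / (2 * ln n%:R) / 2) by rewrite /z; field; rewrite gt_eqF.
  by rewrite ler_wpM2l// ler_pM2r// !div1r lef_pV2 ?posrE ?mulr_gt0.
rewrite zE; apply: (@le_trans _ _ (2 * expR (- (2 * z)))).
  by rewrite ler_pM2l// ler_expR lerN2.
have -> : - (2 * z) = - z - z by ring.
rewrite expRD mulrA ler_piMl ?expR_ge0//.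
rewrite expRN ler_pdivrMr ?expR_gt0// mul1r.
by apply: le_trans (expR_ge1Dx z); lra.
Qed.
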